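(* Let $\alpha\ge 3$, $\beta\ge 0$ and $t_0>0$. For every initial value $(u_0,v_0)\in\mathcal{H}\times\mathcal{H}$ there exists a unique global $C^2$-solution $x:[t_0,+\infty)\to\mathcal{H}$ of the dynamical system $$\ddot{x}(t)+\frac{\alpha}{t}\dot{x}(t)+\beta\nabla^2 g(x(t))\dot{x}(t)+\nabla g(x(t))+\epsilon(t)x(t)=0\quad (t\ge t_0),\qquad x(t_0)=u_0,\ \dot{x}(t_0)=v_0.$$
   Context: $\mathcal{H}$ is a real Hilbert space. Standing assumptions: $g:\mathcal{H}\to\mathbb{R}$ is a convex and twice Fréchet differentiable function with gradient $\nabla g$ Lipschitz continuous on bounded sets, and $\operatorname{argmin} g\ne\emptyset$ ($\nabla^2 g$ denotes the Hessian of $g$); $\epsilon:[t_0,+\infty)\to[0,+\infty)$ is a nonincreasing function of class $C^1$ with $\lim_{t\to+\infty}\epsilon(t)=0$.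
   Formalization: For β > 0 the continuity of the second derivative (the ''C²'' claim) is asserted only if the Hessian of g is strongly continuous, since it fails otherwise; existence and uniqueness of a global twice differentiable solution are proved without this. *)

(* Defs.v *)
From Stdlib Require Import Reals ClassicalEpsilon.
From Coquelicot Require Import Coquelicot.

Set Implicit Arguments.
Unset Strict Implicit.
Unset Printing Implicit Defensive.

Open Scope R_scope.

(* Definiteness of the inner product follows from [hilbert_norm] and
   [norm_eq_zero]. *)
Record Hilbert : Type := {
  hilbert_carrier :> CompleteNormedModule R_AbsRing;
  inner : hilbert_carrier -> hilbert_carrier -> R;
  inner_sym : forall x y, inner x y = inner y x;
  inner_plus_l : forall x y z,
    inner (plus x y) z = inner x z + inner y z;
  inner_scal_l : forall (a : R) x y, inner (scal a x) y = a * inner x y;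
  inner_ge_0 : forall x, 0 <= inner x x;
  hilbert_norm : forall x : hilbert_carrier, norm x = sqrt (inner x x)
}.

(* Total Fréchet differential; meaningful only where [f] is differentiable. *)
Definition frechet {U V : NormedModule R_AbsRing} (f : U -> V) (x : U) :
    U -> V :=
  epsilon (inhabits (fun _ => zero)) (fun l => filterdiff f (locally x) l).

(* The vector representing the differential of [g] at [x], as provided by the
   Riesz representation theorem when [g] is differentiable at [x]. *)
Definition gradient (H : Hilbert) (g : H -> R) (x : H) : H :=
  epsilon (inhabits zero) (fun v => filterdiff g (locally x) (inner v)).

Definition hessian (H : Hilbert) (g : H -> R) (x : H) : H -> H :=
  frechet (gradient g) x.

Definition twice_frechet_differentiable (H : Hilbert) (g : H -> R) : Prop :=
  (forall x : H, ex_filterdiff g (locally x)) /\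
  (forall x : H, ex_filterdiff (gradient g) (locally x)).

(* Continuity of the Hessian in the strong operator topology; weaker than
   continuity in the operator norm, i.e. than [g] being of class C^2. *)
Definition hessian_continuous (H : Hilbert) (g : H -> R) : Prop :=
  forall h x : H, continuous (fun y : H => hessian g y h) x.

Definition convex (H : Hilbert) (g : H -> R) : Prop :=
  forall (x y : H) (a : R), 0 <= a <= 1 ->
    g (plus (scal a x) (scal (1 - a) y)) <= a * g x + (1 - a) * g y.

Definition argmin (H : Hilbert) (g : H -> R) (z : H) : Prop :=
  forall y : H, g z <= g y.

Definition bounded_set (H : Hilbert) (B : H -> Prop) : Prop :=
  exists M : R, forall x : H, B x -> norm x <= M.

Definition lipschitz_on_bounded_sets (H : Hilbert) (F : H -> H) : Prop :=
  forall B : H -> Prop, bounded_set B ->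
    exists L : R, forall x y : H, B x -> B y ->
      norm (minus (F x) (F y)) <= L * norm (minus x y).

(* A function on [t0, +oo) is represented by a total function on [R] of which
   only the restriction matters: limits and derivatives are taken within
   [t0, +oo), hence are one-sided at [t0]. *)
Definition half_line_at (t0 t : R) : (R -> Prop) -> Prop :=
  within (fun s => t0 <= s) (locally t).

Definition derivative_on {V : NormedModule R_AbsRing} (t0 : R)
    (f f' : R -> V) : Prop :=
  forall t : R, t0 <= t ->
    filterdiff f (half_line_at t0 t) (fun h : R => scal h (f' t)).

Definition continuous_on_half_line {V : NormedModule R_AbsRing} (t0 : R)
    (f : R -> V) : Prop :=
  forall t : R, t0 <= t -> filterlim f (half_line_at t0 t) (locally (f t)).

Definition C1_on_half_line (t0 : R) (f : R -> R) : Prop :=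
  exists f' : R -> R,
    derivative_on (V := R_NormedModule) t0 f f' /\
    continuous_on_half_line (V := R_NormedModule) t0 f'.

(* [x] solves the Cauchy problem on [t0, +oo), with first and second
   derivatives [x'] and [x'']. *)
Definition solution (H : Hilbert) (g : H -> R) (eps : R -> R)
    (alpha beta t0 : R) (u0 v0 : H) (x x' x'' : R -> H) : Prop :=
  derivative_on t0 x x' /\
  derivative_on t0 x' x'' /\
  (forall t : R, t0 <= t ->
     plus (x'' t)
       (plus (scal (alpha / t) (x' t))
          (plus (scal beta (hessian g (x t) (x' t)))
             (plus (gradient g (x t)) (scal (eps t) (x t))))) = zero) /\
  x t0 = u0 /\
  x' t0 = v0.

(* Main.v *)
Require Import Defs.
From Stdlib Require Import Reals Lra Lia Psatz ClassicalEpsilon ssreflect.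
From Coquelicot Require Import Coquelicot.
Open Scope R_scope.

(* With the momentum y = x' + beta grad g(x), the equation becomes the
   first-order system
     x' = y - beta grad g(x),
     y' = - (alpha / t) x' - grad g(x) - eps(t) x,
   in which the Hessian no longer occurs and whose field is Lipschitz on
   bounded sets; a Gronwall estimate on |x1 - x2|^2 + |y1 - y2|^2 then gives
   uniqueness.  For existence, grad g(x) is replaced by grad g(P_r(t) x), where
   P_r is the radial projection on the ball of radius r and
   r(t) = |u0| + 1 + C (t - t0); the truncated field is globally Lipschitz on
   compact time intervals, so Picard iteration yields a global solution.  As
   long as |x| <= r, this is a solution of the original system, along which the
   energy g(x) + |x'|^2 / 2 + eps |x|^2 / 2 is nonincreasing, because the
   Hessian of a convex function is positive semidefinite and eps is
   nonincreasing.  As g is bounded below, |x'| <= C for a constant C depending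
   only on the initial data, so |x| < r and the truncation never becomes
   active. *)

(** * The inner product *)

(** A Hessian that exists everywhere need not be continuous, so in the variables (x, x') the field
    itself may be discontinuous; with the momentum, the Hessian returns only when y - beta grad g(x)
    is differentiated afterwards. The second obstacle is that the gradient is Lipschitz only on
    bounded sets, while the energy gives no bound on |x| uniform in time, its weight eps tending to
    zero. It does bound the speed, hence |x(t)| <= |u0| + C (t - t0), which is why the truncation
    ball grows linearly. Truncating before solving lets Picard iteration reach the whole half-line
    at once, in place of a maximal solution and a blow-up argument. Since the energy is known to
    decrease only while the trajectory stays in the ball, confinement is a bootstrap: the additional
    1 in r turns the nonstrict bound up to time t into a strict one at t. *)

Lemma inner_zero_l (H : Hilbert) (y : H) : inner zero y = 0.
Proof.
  rewrite -(scal_zero_l (zero : H)) inner_scal_l.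
  apply Rmult_0_l.
Qed.

Lemma inner_opp_l (H : Hilbert) (x y : H) : inner (opp x) y = - inner x y.
Proof.
  rewrite -(scal_opp_one x) inner_scal_l. change (opp one) with (-1). ring.
Qed.

Lemma inner_minus_l (H : Hilbert) (x y z : H) :
  inner (minus x y) z = inner x z - inner y z.
Proof. unfold minus. rewrite inner_plus_l inner_opp_l. ring. Qed.

Lemma inner_plus_r (H : Hilbert) (x y z : H) :
  inner z (plus x y) = inner z x + inner z y.
Proof. rewrite !(inner_sym z). apply inner_plus_l. Qed.

Lemma inner_scal_r (H : Hilbert) (a : R) (x y : H) :
  inner x (scal a y) = a * inner x y.
Proof. rewrite !(inner_sym x). apply inner_scal_l. Qed.

Lemma inner_opp_r (H : Hilbert) (x y : H) : inner x (opp y) = - inner x y.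
Proof. rewrite !(inner_sym x). apply inner_opp_l. Qed.

Lemma inner_minus_r (H : Hilbert) (x y z : H) :
  inner z (minus x y) = inner z x - inner z y.
Proof. rewrite !(inner_sym z). apply inner_minus_l. Qed.

Lemma inner_zero_r (H : Hilbert) (x : H) : inner x zero = 0.
Proof. rewrite inner_sym. apply inner_zero_l. Qed.

Ltac inner_expand :=
  rewrite ?(inner_minus_l, inner_minus_r, inner_plus_l, inner_plus_r,
    inner_opp_l, inner_opp_r, inner_scal_l, inner_scal_r,
    inner_zero_l, inner_zero_r).

Lemma norm_sqr (H : Hilbert) (x : H) : norm x * norm x = inner x x.
Proof. rewrite hilbert_norm. apply sqrt_sqrt, inner_ge_0. Qed.

Lemma norm_minus_sqr (H : Hilbert) (x y : H) :
  norm (minus x y) * norm (minus x y) = inner x x - 2 * inner x y + inner y y.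
Proof. rewrite norm_sqr. inner_expand. rewrite (inner_sym y x). ring. Qed.

Lemma inner_self_eq_zero (H : Hilbert) (x : H) : inner x x = 0 -> x = zero.
Proof.
  intros Hx. refine (norm_eq_zero x _). rewrite hilbert_norm Hx. apply sqrt_0.
Qed.

Lemma inner_ext (H : Hilbert) (x y : H) :
  (forall h, inner x h = inner y h) -> x = y.
Proof.
  intros Hxy.
  assert (Hd : minus x y = zero).
  { apply inner_self_eq_zero. rewrite inner_minus_l Hxy. ring. }
  rewrite -(plus_zero_l y) -Hd. unfold minus.
  now rewrite -plus_assoc plus_opp_l plus_zero_r.
Qed.

(* Identities between vectors are tested against all vectors, where they become
   identities of real numbers. *)
Ltac hilbert_ring :=
  apply inner_ext; intros ?h; inner_expand; ring.

(** Expanding the square of | |y| x - |x| y | leaves 2 |x| |y| (|x| |y| - <x, y>) >= 0; dividing by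
    |x| |y| is what forces the two degenerate cases. *)
Lemma cauchy_schwarz_le (H : Hilbert) (x y : H) :
  inner x y <= norm x * norm y.
Proof.
  pose proof (norm_ge_0 x) as Hx. pose proof (norm_ge_0 y) as Hy.
  destruct (Req_dec (norm x) 0) as [E | E].
  { rewrite (norm_eq_zero x E) inner_zero_l norm_zero. lra. }
  destruct (Req_dec (norm y) 0) as [E' | E'].
  { rewrite (norm_eq_zero y E') inner_zero_r norm_zero. lra. }
  pose proof (inner_ge_0
    (minus (scal (norm y) x) (scal (norm x) y))) as Hd.
  revert Hd. inner_expand. rewrite (inner_sym y x) -!norm_sqr. intros Hd.
  assert (0 < norm x * norm y) by (apply Rmult_lt_0_compat; lra).
  nra.
Qed.

Lemma cauchy_schwarz (H : Hilbert) (x y : H) :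
  Rabs (inner x y) <= norm x * norm y.
Proof.
  apply Rabs_le. split; [| apply cauchy_schwarz_le].
  pose proof (cauchy_schwarz_le H (opp x) y) as Ho.
  rewrite inner_opp_l norm_opp in Ho. lra.
Qed.

Lemma norm_prod_ge (U V : NormedModule R_AbsRing) (p : U * V) :
  norm (fst p) <= norm p /\ norm (snd p) <= norm p.
Proof.
  destruct p as [a b]. destruct (norm_prod a b) as [Hm _].
  simpl. split; (eapply Rle_trans; [| exact Hm]);
    [apply Rmax_l | apply Rmax_r].
Qed.

Lemma norm_prod_le (U V : NormedModule R_AbsRing) (p : U * V) :
  norm p <= norm (fst p) + norm (snd p).
Proof.
  pose proof (norm_ge_0 (fst p)). pose proof (norm_ge_0 (snd p)).
  change (norm p) with (sqrt (norm (fst p) ^ 2 + norm (snd p) ^ 2)).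
  rewrite -(sqrt_Rsqr (norm (fst p) + norm (snd p))); [| lra].
  apply sqrt_le_1_alt. unfold Rsqr. nra.
Qed.

(** By bilinearity the first-order remainder is exactly the inner product of the two increments,
    hence at most the square of the norm of the joint increment. *)
Lemma filterdiff_inner (H : Hilbert) (x y : H) :
  filterdiff (fun p : prod_NormedModule R_AbsRing H H =>
      inner (fst p) (snd p) : R_NormedModule)
    (locally (x, y))
    (fun p => inner (fst p) y + inner x (snd p)).
Proof.
  assert (Hl : is_linear (U := prod_NormedModule R_AbsRing H H)
    (V := R_NormedModule) (fun p => inner (fst p) y + inner x (snd p))).
  { split.
    - intros [a b] [c d]. simpl. inner_expand.
      change (@plus R_NormedModule) with Rplus. ring.
    - intros k [a b]. simpl. inner_expand.
      change (@scal R_AbsRing R_NormedModule) with Rmult. ring.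
    - exists (norm y + norm x + 1).
      pose proof (norm_ge_0 x). pose proof (norm_ge_0 y). split; [lra |].
      intros p. destruct (norm_prod_ge _ _ p) as [Hp1 Hp2].
      pose proof (norm_ge_0 (fst p)). pose proof (norm_ge_0 (snd p)).
      change (norm (inner (fst p) y + inner x (snd p)))
        with (Rabs (inner (fst p) y + inner x (snd p))).
      eapply Rle_trans; [apply Rabs_triang |].
      pose proof (cauchy_schwarz H (fst p) y).
      pose proof (cauchy_schwarz H x (snd p)). nra. }
  split; [exact Hl |].
  intros q Hq eps.
  apply is_filter_lim_locally_close, eq_close in Hq. subst q.
  generalize (locally_ball_norm (x, y) eps).
  apply filter_imp. intros p Hp. unfold ball_norm in Hp.
  set (d := minus p (x, y)) in *.
  assert (E : inner (fst p) (snd p) - inner x y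
    - (inner (fst d) y + inner x (snd d)) = inner (fst d) (snd d)).
  { destruct p as [a b]. subst d. simpl. inner_expand. ring. }
  change (norm (inner (fst p) (snd p) - inner x y
    - (inner (fst d) y + inner x (snd d))) <= eps * norm d).
  rewrite E.
  change (norm (inner (fst d) (snd d))) with (Rabs (inner (fst d) (snd d))).
  eapply Rle_trans; [apply cauchy_schwarz |].
  destruct (norm_prod_ge _ _ d) as [Hp1 Hp2].
  pose proof (norm_ge_0 (fst d)). pose proof (norm_ge_0 (snd d)).
  nra.
Qed.

(** * Riesz representation *)

Lemma riesz (H : Hilbert) (l : H -> R) :
  is_linear (U := H) (V := R_NormedModule) l ->
  exists v : H, forall h, inner v h = l h.
Proof.
  intros Hl.
  assert (l_plus : forall x y, l (plus x y) = l x + l y)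
    by (intros; apply (linear_plus _ Hl)).
  assert (l_scal : forall a x, l (scal a x) = a * l x)
    by (intros; apply (linear_scal _ Hl)).
  destruct (linear_norm _ Hl) as [M [HM l_norm]].
  (* The representing vector is the maximizer of [Q]; the sets where [Q] is
     almost maximal form a Cauchy filter by the parallelogram identity. *)
  set (Q := fun v => 2 * l v - inner v v).
  destruct (completeness (fun z => exists v, z = Q v)) as [m [Hub Hlub]].
  { exists (M * M). intros z [v ->]. unfold Q. rewrite -norm_sqr.
    pose proof (Rle_trans _ _ _ (Rle_abs (l v)) (l_norm v)).
    pose proof (Rle_0_sqr (M - norm v)). unfold Rsqr in *. lra. }
  { exists (Q zero). now exists zero. }
  assert (Qm : forall v, Q v <= m) by (intros v; apply Hub; now exists v).
  set (F := fun P : H -> Prop =>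
    exists d : posreal, forall v, m - d < Q v -> P v).
  assert (HF : ProperFilter F).
  { split; [| split].
    - intros P [d Hd].
      destruct (classic (exists v, m - d < Q v)) as [[v Hv] | Hn].
      { exists v. now apply Hd. }
      assert (m <= m - d); [| destruct d; simpl in *; lra].
      apply Hlub. intros z [v ->].
      apply Rnot_lt_le. intros Hv. apply Hn. now exists v.
    - exists (mkposreal 1 Rlt_0_1). trivial.
    - intros P P' [d Hd] [d' Hd'].
      assert (Hm : 0 < Rmin d d')
        by (apply Rmin_pos; [apply d | apply d']).
      exists (mkposreal _ Hm). simpl. intros v Hv.
      pose proof (Rmin_l d d'). pose proof (Rmin_r d d').
      split; [apply Hd | apply Hd']; lra.
    - intros P P' HP [d Hd]. exists d. auto. }
  assert (Hc : cauchy F).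
  { intros e.
    (* Half of |b - a|^2 equals 2 Q((a + b) / 2) - Q(a) - Q(b), which is below 2 d; so |b - a|^2 < 4
       d = e^2 / 2. *)
    assert (He : 0 < e * e / 8) by (pose proof (cond_pos e); nra).
    set (d := mkposreal _ He).
    destruct (filter_ex (F := F) (fun v => m - d < Q v)) as [a Ha].
    { now exists d. }
    exists a, d. intros b Hb. apply: norm_compat1.
    pose proof (Qm (scal (/ 2) (plus a b))) as Hmid.
    unfold Q in Ha, Hb, Hmid. simpl in Ha, Hb.
    rewrite l_scal l_plus in Hmid. revert Hmid. inner_expand.
    rewrite (inner_sym b a). intros Hmid.
    pose proof (norm_minus_sqr H b a) as Hn. rewrite (inner_sym b a) in Hn.
    apply Rnot_le_lt. intros Hle.
    assert (e * e <= norm (minus b a) * norm (minus b a))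
      by (pose proof (cond_pos e); apply Rmult_le_compat; (lra || exact Hle)).
    lra. }
  (* [Q] is perturbed at an almost maximal [w] near [lim F], not at [lim F] itself. If the defect
     [D] were nonzero, the defect [s] of [w] would be at least half as large, and moving [w] by s /
     (n + 1) along [h] would raise [Q] by at least s^2 / (n + 1) >= 2 d, more than the [d] still
     available. Using n + 1 keeps the quotient meaningful for h = 0. *)
  exists (lim F). intros h.
  set (D := l h - inner (lim F) h).
  apply Rminus_diag_uniq_sym. fold D.
  apply NNPP. intros HD.
  set (n := inner h h). pose proof (inner_ge_0 h) as Hn. fold n in Hn.
  assert (HD2 : 0 < D * D) by now apply Rsqr_pos_lt.
  assert (Hd : 0 < D * D / (8 * (n + 1))) by (apply Rdiv_lt_0_compat; lra).
  set (d := mkposreal _ Hd).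
  pose proof (norm_ge_0 h).
  assert (He : 0 < Rabs D / (2 * (norm h + 1))).
  { apply Rdiv_lt_0_compat; [now apply Rabs_pos_lt | lra]. }
  set (e := mkposreal _ He).
  assert (Fe : F (ball_norm (lim F) e)).
  { destruct (locally_ball_norm (lim F) e) as [e' He'].
    apply: filter_imp (complete_cauchy F HF Hc e'). exact He'. }
  assert (Fd : F (fun v => m - d < Q v)) by now exists d.
  destruct (filter_ex _ (filter_and _ _ Fe Fd)) as [w [Hw Hwd]].
  unfold ball_norm in Hw.
  set (s := l h - inner w h).
  assert (Hs : Rabs (D - s) <= Rabs D / 2).
  { replace (D - s) with (inner (minus w (lim F)) h)
      by (unfold D, s; rewrite inner_minus_l; ring).
    eapply Rle_trans; [apply cauchy_schwarz |].
    apply Rle_trans with (e * (norm h + 1)).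
    - pose proof (norm_ge_0 (minus w (lim F))). nra.
    - right. simpl. field. lra. }
  assert (Hs2 : D * D / 4 <= s * s).
  { revert Hs. unfold Rabs. repeat destruct Rcase_abs; nra. }
  pose proof (Qm (plus w (scal (s / (n + 1)) h))) as Hq.
  unfold Q in Hq, Hwd. rewrite l_plus l_scal in Hq. revert Hq. inner_expand.
  rewrite (inner_sym h w). fold n.
  replace (l h) with (s + inner w h) by (unfold s; ring). intros Hq.
  assert (s * s / (n + 1) <= d).
  { apply Rle_trans with (2 * (s / (n + 1)) * s - (s / (n + 1)) ^ 2 * n).
    - replace (2 * (s / (n + 1)) * s - (s / (n + 1)) ^ 2 * n)
        with (s * s / (n + 1) + (s / (n + 1)) ^ 2) by (field; lra).
      pose proof (pow2_ge_0 (s / (n + 1))). lra.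
    - lra. }
  assert (D * D / 4 / (n + 1) <= d).
  { eapply Rle_trans; [| eassumption].
    apply Rmult_le_compat_r; [| exact Hs2].
    left. apply Rinv_0_lt_compat. lra. }
  replace (D * D / 4 / (n + 1)) with (2 * d) in * by (simpl; field; lra).
  pose proof (cond_pos d). lra.
Qed.

(** Riesz representation provides the witness that makes the choice by [epsilon] in [gradient]
    meaningful. *)
Lemma gradient_spec (H : Hilbert) (g : H -> R) (x : H) :
  ex_filterdiff (V := R_NormedModule) g (locally x) ->
  filterdiff (V := R_NormedModule) g (locally x) (inner (gradient g x)).
Proof.
  intros [l Hl]. unfold gradient. apply epsilon_spec.
  destruct (riesz _ _ (proj1 Hl)) as [v Hv]. exists v.
  apply: filterdiff_ext_lin; [exact Hl | now intros y].
Qed.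

Lemma hessian_spec (H : Hilbert) (g : H -> R) (x : H) :
  ex_filterdiff (gradient g) (locally x) ->
  filterdiff (gradient g) (locally x) (hessian g x).
Proof.
  intros [l Hl]. unfold hessian, frechet. apply epsilon_spec. now exists l.
Qed.

(** * Completeness of products, for the phase space of pairs (x, y) *)

Definition prod_lim (U V : CompleteSpace) (F : (U * V -> Prop) -> Prop) :
    U * V :=
  (lim (filtermap fst F), lim (filtermap snd F)).

Lemma prod_complete_cauchy (U V : CompleteSpace) (F : (U * V -> Prop) -> Prop) :
  ProperFilter F -> cauchy (T := prod_UniformSpace U V) F ->
  forall eps : posreal,
    F (ball (M := prod_UniformSpace U V) (prod_lim U V F) eps).
Proof.
  intros FF HF eps.
  apply filter_and.
  - apply (complete_cauchy (filtermap fst F)).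
    + apply filtermap_proper_filter, FF.
    + intros e. destruct (HF e) as [x Hx]. exists (fst x).
      unfold filtermap. apply: filter_imp Hx. now intros y [Hy _].
  - apply (complete_cauchy (filtermap snd F)).
    + apply filtermap_proper_filter, FF.
    + intros e. destruct (HF e) as [x Hx]. exists (snd x).
      unfold filtermap. apply: filter_imp Hx. now intros y [_ Hy].
Qed.

Lemma prod_close_lim (U V : CompleteSpace) (F1 F2 : (U * V -> Prop) -> Prop) :
  filter_le F1 F2 -> filter_le F2 F1 ->
  close (M := prod_UniformSpace U V) (prod_lim U V F1) (prod_lim U V F2).
Proof.
  intros H12 H21 eps.
  split; apply close_lim; intros P HP; unfold filtermap in *; auto.
Qed.

Definition prod_CompleteNormedModule (K : AbsRing)
    (U V : CompleteNormedModule K) : CompleteNormedModule K :=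
  CompleteNormedModule.Pack K (U * V)
    (CompleteNormedModule.Class K (U * V)
      (NormedModule.class K (prod_NormedModule K U V))
      (CompleteSpace.Mixin (prod_UniformSpace U V) (prod_lim U V)
        (prod_complete_cauchy U V) (prod_close_lim U V)))
    (U * V).

(** * One-sided derivatives and monotonicity *)

Lemma is_filter_lim_half_line (t0 t : R) : is_filter_lim (half_line_at t0 t) t.
Proof. intros P HP. now apply filter_le_within. Qed.

Lemma half_line_proper (t0 t : R) : t0 <= t -> ProperFilter (half_line_at t0 t).
Proof.
  intros Ht. split.
  - intros P [e He]. exists (t + e / 2). pose proof (cond_pos e).
    apply He; [| lra].
    change (Rabs (t + e / 2 - t) < e).
    rewrite Rabs_pos_eq; lra.
  - apply within_filter, locally_filter.
Qed.

(** Only increments to the right of [t] are tested; they stay in the half-line even at [t0]. The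
    gradient inequality, the sign and the size of the Hessian and the sign of the derivative of eps
    are all read off from this. *)
Lemma derivative_le (t0 t d c l : R) (f : R -> R) :
  t0 <= t -> 0 < d ->
  filterdiff (V := R_NormedModule) f (half_line_at t0 t) (fun h => scal h l) ->
  (forall s, t < s < t + d -> f s - f t <= c * (s - t)) -> l <= c.
Proof.
  intros Ht Hd [_ Hf] Hs.
  apply Rnot_lt_le. intros Hc.
  assert (He : 0 < (l - c) / 2) by lra.
  destruct (Hf t (is_filter_lim_half_line t0 t) (mkposreal _ He)) as [e Hb].
  set (k := Rmin d e / 2).
  assert (0 < k < d /\ k < e).
  { pose proof (Rmin_l d e). pose proof (Rmin_r d e).
    assert (0 < Rmin d e) by (apply Rmin_pos; [lra | apply e]).
    unfold k. lra. }
  specialize (Hb (t + k)). specialize (Hs (t + k)).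
  assert (Hb' : Rabs (f (t + k) - f t - (t + k - t) * l)
    <= (l - c) / 2 * Rabs (t + k - t)).
  { apply Hb; [| lra]. change (Rabs (t + k - t) < e).
    rewrite Rabs_pos_eq; lra. }
  rewrite (Rabs_pos_eq (t + k - t)) in Hb'; [| lra].
  apply Rabs_le_between in Hb'.
  assert (f (t + k) - f t <= c * (t + k - t)) by (apply Hs; lra).
  nra.
Qed.

(** Clamping at [t0] is 1-Lipschitz with values in the half-line, so one-sided continuity becomes
    continuity on the whole line, where two-sided theorems apply. *)
Lemma continuous_clamp (V : NormedModule R_AbsRing) (t0 t : R) (f : R -> V) :
  filterlim f (half_line_at t0 (Rmax t t0)) (locally (f (Rmax t t0))) ->
  continuous (fun s => f (Rmax s t0)) t.
Proof.
  intros Hf P HP. specialize (Hf P HP).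
  destruct Hf as [e He]. exists e. intros s Hs.
  apply He; [| apply Rmax_r].
  change (Rabs (Rmax s t0 - Rmax t t0) < e).
  change (Rabs (s - t) < e) in Hs.
  revert Hs. unfold Rmax, Rabs.
  repeat destruct Rle_dec; repeat destruct Rcase_abs; lra.
Qed.

Lemma filterdiff_half_line_continuous (V : NormedModule R_AbsRing) (t0 t : R)
    (f : R -> V) (l : R -> V) :
  filterdiff f (half_line_at t0 t) l ->
  filterlim f (half_line_at t0 t) (locally (f t)).
Proof.
  intros Hf. apply: filterdiff_continuous_aux.
  - now exists l.
  - apply is_filter_lim_half_line.
Qed.

(** The mean value theorem is applied to the clamped function: it is continuous up to [t0], and at
    interior points the clamp is locally invisible, so the one-sided derivative is an ordinary
    one. *)
Lemma nonincreasing_of_derivative_nonpos (t0 T : R) (f f' : R -> R) :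
  t0 <= T ->
  (forall t, t0 <= t <= T ->
    filterdiff (V := R_NormedModule) f (half_line_at t0 t)
      (fun h => scal h (f' t))) ->
  (forall t, t0 <= t <= T -> f' t <= 0) ->
  f T <= f t0.
Proof.
  intros HT Hf Hneg.
  destruct (MVT_gen (fun s => f (Rmax s t0)) t0 T f') as [c [Hc E]].
  - rewrite Rmin_left // Rmax_right //. intros t Ht.
    destruct (Hf t) as [Hlin Hd]; [lra |].
    split; [exact Hlin |].
    intros t' Ht' eps.
    apply is_filter_lim_locally_close, eq_close in Ht'. subst t'.
    specialize (Hd t (is_filter_lim_half_line t0 t) eps).
    assert (Hgt : locally t (fun s => t0 < s)) by (apply open_gt; lra).
    unfold half_line_at, within in Hd.
    apply: filter_imp (filter_and _ _ Hd Hgt). intros s [Hs Hst].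
    rewrite (Rmax_left s) ?(Rmax_left t); [| lra | lra].
    apply Hs. lra.
  - rewrite Rmin_left // Rmax_right //. intros t Ht.
    apply continuity_pt_filterlim.
    apply (continuous_clamp R_NormedModule t0 t f).
    rewrite Rmax_left; [| lra].
    apply: filterdiff_half_line_continuous. apply Hf. lra.
  - rewrite Rmin_left // Rmax_right // in Hc.
    rewrite (Rmax_left T) // (Rmax_left t0) in E; [| lra].
    specialize (Hneg c Hc). nra.
Qed.

(** * Derivatives on a half-line *)

Lemma half_line_comp (U V : NormedModule R_AbsRing) (t0 t : R)
    (f : R -> U) (f' : U) (G : U -> V) (lG : U -> V) :
  filterdiff f (half_line_at t0 t) (fun h : R => scal h f') ->
  filterdiff G (locally (f t)) lG -> t0 <= t ->
  filterdiff (fun s => G (f s)) (half_line_at t0 t)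
    (fun h : R => scal h (lG f')).
Proof.
  intros Hf HG Ht.
  pose proof (half_line_proper t0 t Ht) as HP.
  apply filterdiff_ext_lin with (fun h : R => lG (scal h f')).
  - apply: (filterdiff_comp f G); [exact Hf |].
    apply: filterdiff_locally; [| exact HG].
    apply: filterdiff_half_line_continuous. exact Hf.
  - intros h. exact (linear_scal _ (proj1 HG) h f').
Qed.

Lemma half_line_comp_2 (U V W : NormedModule R_AbsRing) (t0 t : R)
    (f : R -> U) (f' : U) (k : R -> V) (k' : V) (G : U -> V -> W)
    (lG : U -> V -> W) :
  filterdiff f (half_line_at t0 t) (fun h : R => scal h f') ->
  filterdiff k (half_line_at t0 t) (fun h : R => scal h k') ->
  filterdiff (fun p : prod_NormedModule R_AbsRing U V => G (fst p) (snd p))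
    (locally (f t, k t)) (fun p => lG (fst p) (snd p)) -> t0 <= t ->
  filterdiff (fun s => G (f s) (k s)) (half_line_at t0 t)
    (fun h : R => scal h (lG f' k')).
Proof.
  intros Hf Hk HG Ht.
  pose proof (half_line_proper t0 t Ht) as HP.
  apply filterdiff_ext_lin with (fun h : R => lG (scal h f') (scal h k')).
  - refine (filterdiff_comp_2 f k G _ _ lG Hf Hk _).
    refine (filterdiff_locally
      (F := filtermap (fun s => (f s, k s)) (half_line_at t0 t))
      (FF := @filtermap_proper_filter _ _ _ _ HP) _ (f t, k t) _ _ HG).
    intros P [e He].
    pose proof (filterdiff_half_line_continuous U t0 t f _ Hf) as Cf.
    pose proof (filterdiff_half_line_continuous V t0 t k _ Hk) as Ck.
    assert (HB : half_line_at t0 t (fun s =>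
      ball (f t) e (f s) /\ ball (k t) e (k s))).
    { apply filter_and;
        [exact (Cf _ (locally_ball _ e)) | exact (Ck _ (locally_ball _ e))]. }
    revert HB. unfold filtermap. apply filter_imp.
    intros s Hs. apply He. exact Hs.
  - intros h. apply (linear_scal _ (proj1 HG) h (f', k')).
Qed.

Lemma half_line_inner (H : Hilbert) (t0 t : R) (f k : R -> H) (f' k' : H) :
  filterdiff f (half_line_at t0 t) (fun h : R => scal h f') ->
  filterdiff k (half_line_at t0 t) (fun h : R => scal h k') -> t0 <= t ->
  filterdiff (V := R_NormedModule) (fun s => inner (f s) (k s))
    (half_line_at t0 t)
    (fun h : R => scal h (inner f' (k t) + inner (f t) k')).
Proof.
  intros Hf Hk Ht.
  apply: (half_line_comp_2 H H R_NormedModule t0 t f f' k k'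
    (fun a b => inner a b) (fun a b => inner a (k t) + inner (f t) b)
    Hf Hk _ Ht).
  apply filterdiff_inner.
Qed.

Lemma half_line_mult (t0 t : R) (f k : R -> R) (f' k' : R) :
  filterdiff (V := R_NormedModule) f (half_line_at t0 t)
    (fun h : R => scal h f') ->
  filterdiff (V := R_NormedModule) k (half_line_at t0 t)
    (fun h : R => scal h k') -> t0 <= t ->
  filterdiff (V := R_NormedModule) (fun s => f s * k s)
    (half_line_at t0 t)
    (fun h : R => scal h (f' * k t + f t * k')).
Proof.
  intros Hf Hk Ht.
  apply: (half_line_comp_2 R_NormedModule R_NormedModule R_NormedModule
    t0 t f f' k k' Rmult (fun a b => a * k t + f t * b) Hf Hk _ Ht).
  exact (filterdiff_mult (K := R_AbsRing) (f t, k t)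
    (fun P HP => HP) Rmult_comm).
Qed.

Lemma half_line_plus (V : NormedModule R_AbsRing) (t0 t : R)
    (f k : R -> V) (f' k' : V) :
  filterdiff f (half_line_at t0 t) (fun h : R => scal h f') ->
  filterdiff k (half_line_at t0 t) (fun h : R => scal h k') -> t0 <= t ->
  filterdiff (fun s => plus (f s) (k s)) (half_line_at t0 t)
    (fun h : R => scal h (plus f' k')).
Proof.
  intros Hf Hk Ht. pose proof (half_line_proper t0 t Ht) as HP.
  apply: filterdiff_ext_lin;
    [apply: filterdiff_plus_fct; [exact Hf | exact Hk] |].
  intros h. simpl. symmetry. apply: scal_distr_l.
Qed.

Lemma half_line_minus (V : NormedModule R_AbsRing) (t0 t : R)
    (f k : R -> V) (f' k' : V) :
  filterdiff f (half_line_at t0 t) (fun h : R => scal h f') ->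
  filterdiff k (half_line_at t0 t) (fun h : R => scal h k') -> t0 <= t ->
  filterdiff (fun s => minus (f s) (k s)) (half_line_at t0 t)
    (fun h : R => scal h (minus f' k')).
Proof.
  intros Hf Hk Ht. pose proof (half_line_proper t0 t Ht) as HP.
  apply: filterdiff_ext_lin;
    [apply: filterdiff_minus_fct; [exact Hf | exact Hk] |].
  intros h. simpl. symmetry. apply: scal_minus_distr_l.
Qed.

Lemma half_line_scal (V : NormedModule R_AbsRing) (t0 t a : R)
    (f : R -> V) (f' : V) :
  filterdiff f (half_line_at t0 t) (fun h : R => scal h f') -> t0 <= t ->
  filterdiff (fun s => scal a (f s)) (half_line_at t0 t)
    (fun h : R => scal h (scal a f')).
Proof.
  intros Hf Ht.
  apply: half_line_comp Hf _ Ht.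
  apply: filterdiff_linear.
  apply: (is_linear_scal_r a). intros n m. apply Rmult_comm.
Qed.

Lemma half_line_of_is_derive (V : NormedModule R_AbsRing) (t0 t : R)
    (f : R -> V) (f' : V) :
  is_derive f t f' -> t0 <= t ->
  filterdiff f (half_line_at t0 t) (fun h : R => scal h f').
Proof.
  intros Hf Ht. pose proof (half_line_proper t0 t Ht) as HP.
  apply: filterdiff_locally Hf. apply is_filter_lim_half_line.
Qed.

Lemma is_derive_line (V : NormedModule R_AbsRing) (x k : V) (t : R) :
  is_derive (fun s : R => plus x (scal s k)) t k.
Proof.
  rewrite -{2}(scal_one k) -(plus_zero_l (scal one k)).
  apply (is_derive_plus (K := R_AbsRing) (fun _ => x)).
  - apply is_derive_const.
  - apply (is_derive_scal_l (K := R_AbsRing) (fun s => s)), is_derive_id.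
Qed.

(** Restricting to a ray puts the value of the differential at [k] in the form required by
    [derivative_le] at t = t0 = 0. *)
Lemma half_line_along (H : Hilbert) (V : NormedModule R_AbsRing) (G lG : H -> V)
    (x k : H) :
  filterdiff G (locally x) lG ->
  filterdiff (fun s : R => G (plus x (scal s k))) (half_line_at 0 0)
    (fun h : R => scal h (lG k)).
Proof.
  intros HG.
  apply (half_line_comp H V 0 0 (fun s : R => plus x (scal s k)) k G lG);
    [| | lra].
  - apply half_line_of_is_derive; [apply is_derive_line | lra].
  - replace (plus x (scal 0 k)) with x by hilbert_ring. exact HG.
Qed.

(** * First- and second-order consequences of convexity and of the Lipschitz bound *)

(** Convexity bounds every difference quotient along the segment from [x] to [y] by g(y) - g(x). *)
Lemma convex_gradient_le (H : Hilbert) (g : H -> R) (x y : H) :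
  convex g -> ex_filterdiff (V := R_NormedModule) g (locally x) ->
  inner (gradient g x) (minus y x) <= g y - g x.
Proof.
  intros Hc Hd.
  apply: (derivative_le 0 0 1 _ _ _ (Rle_refl 0) Rlt_0_1
    (half_line_along _ _ _ _ _ (minus y x) (gradient_spec _ _ _ Hd))).
  intros s Hs. simpl.
  replace (plus x (scal s (minus y x)))
    with (plus (scal s y) (scal (1 - s) x)) by hilbert_ring.
  replace (plus x (scal 0 (minus y x))) with x by hilbert_ring.
  assert (0 <= s <= 1) as Hs' by lra.
  pose proof (Hc y x s Hs'). lra.
Qed.

Lemma gradient_monotone (H : Hilbert) (g : H -> R) (x y : H) :
  convex g ->
  (forall z, ex_filterdiff (V := R_NormedModule) g (locally z)) ->
  0 <= inner (minus (gradient g y) (gradient g x)) (minus y x).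
Proof.
  intros Hc Hd.
  pose proof (convex_gradient_le H g x y Hc (Hd x)) as Hx.
  pose proof (convex_gradient_le H g y x Hc (Hd y)) as Hy.
  revert Hx Hy. inner_expand. lra.
Qed.

(** Monotonicity of the gradient between x and x + s h is divided by s and passed to the limit;
    testing against [opp h] turns the lower bound into the upper bound that [derivative_le]
    handles. *)
Lemma hessian_nonneg (H : Hilbert) (g : H -> R) (x h : H) :
  convex g -> twice_frechet_differentiable g ->
  0 <= inner (hessian g x h) h.
Proof.
  intros Hc [Hd Hd2].
  assert (Hneg : - inner (hessian g x h) h <= 0); [| lra].
  pose proof (half_line_along _ _ _ _ _ h (hessian_spec _ _ _ (Hd2 x))) as Hh.
  apply: (derivative_le 0 0 1 0 _
    (fun s => inner (gradient g (plus x (scal s h))) (opp h))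
    (Rle_refl 0) Rlt_0_1).
  - replace (- inner (hessian g x h) h) with
      (inner (hessian g x h) (opp h) +
       inner (gradient g (plus x (scal 0 h))) zero) by (inner_expand; ring).
    apply: half_line_inner Hh _ (Rle_refl 0).
    apply: half_line_of_is_derive (Rle_refl 0). apply: is_derive_const.
  - intros s Hs. simpl.
    pose proof (gradient_monotone H g x (plus x (scal s h)) Hc Hd) as Hm.
    replace (minus (plus x (scal s h)) x) with (scal s h) in Hm by hilbert_ring.
    replace (plus x (scal 0 h)) with x by hilbert_ring.
    revert Hm. inner_expand. intros Hm. nra.
Qed.

(** Differentiating the gradient along the ray and testing against the value k of the Hessian gives
    |k|^2 <= L |h| |k|. The length (r - |x|) / (|h| + 1) keeps the ray inside the ball. *)
Lemma hessian_norm_le (H : Hilbert) (g : H -> R) (r L : R) (x h : H) :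
  0 <= L ->
  (forall y z : H, norm y <= r -> norm z <= r ->
    norm (minus (gradient g y) (gradient g z)) <= L * norm (minus y z)) ->
  ex_filterdiff (gradient g) (locally x) -> norm x < r ->
  norm (hessian g x h) <= L * norm h.
Proof.
  intros HL0 HL Hd Hx.
  set (k := hessian g x h).
  pose proof (half_line_along _ _ _ _ _ h (hessian_spec _ _ _ Hd)) as Hh.
  pose proof (norm_ge_0 h) as Hh0.
  assert (Hk : inner k k <= L * norm h * norm k).
  { apply: (derivative_le 0 0 ((r - norm x) / (norm h + 1)) _ _
      (fun s => inner (gradient g (plus x (scal s h))) k) (Rle_refl 0)).
    - apply Rdiv_lt_0_compat; lra.
    - replace (inner k k) with
        (inner k k + inner (gradient g (plus x (scal 0 h))) zero)
        by (inner_expand; ring).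
      apply: half_line_inner Hh _ (Rle_refl 0).
      apply: half_line_of_is_derive (Rle_refl 0). apply: is_derive_const.
    - intros s Hs. simpl.
      replace (plus x (scal 0 h)) with x by hilbert_ring.
      rewrite -inner_minus_l.
      eapply Rle_trans; [apply cauchy_schwarz_le |].
      replace (L * norm h * norm k * (s - 0)) with (L * (s * norm h) * norm k)
        by ring.
      apply Rmult_le_compat_r; [apply norm_ge_0 |].
      assert (Hsh : norm (scal s h) <= s * norm h).
      { eapply Rle_trans; [apply: norm_scal |].
        change (abs s) with (Rabs s). rewrite Rabs_pos_eq; lra. }
      assert (Hs1 : s * (norm h + 1) <= r - norm x).
      { replace (r - norm x) with ((r - norm x) / (norm h + 1) * (norm h + 1))
          by (field; lra).
        apply Rmult_le_compat_r; lra. }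
      eapply Rle_trans; [apply HL |].
      + eapply Rle_trans; [apply: norm_triangle | nra].
      + lra.
      + replace (minus (plus x (scal s h)) x) with (scal s h) by hilbert_ring.
        now apply Rmult_le_compat_l. }
  rewrite -norm_sqr in Hk.
  destruct (norm_ge_0 k) as [Hk0 | Hk0].
  - apply Rmult_le_reg_r with (norm k); [exact Hk0 | lra].
  - rewrite -Hk0. apply Rmult_le_pos; assumption.
Qed.

(** * Global solutions of Lipschitz equations *)

Lemma norm_minus_triangle (V : CompleteNormedModule R_AbsRing) (x y z : V) :
  norm (minus x z) <= norm (minus x y) + norm (minus y z).
Proof. rewrite (minus_trans y x z). apply: norm_triangle. Qed.

Lemma norm_minus_sym (V : CompleteNormedModule R_AbsRing) (x y : V) :
  norm (minus x y) = norm (minus y x).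
Proof. rewrite -(norm_opp (minus x y)). now rewrite opp_minus. Qed.

Lemma exists_mul_pow_half_lt (C e : R) :
  0 <= C -> 0 < e -> exists N, C * (/ 2) ^ N < e.
Proof.
  intros HC He.
  destruct (pow_lt_1_zero (/ 2)) with (y := e / (C + 1)) as [N HN].
  - rewrite Rabs_pos_eq; lra.
  - apply Rdiv_lt_0_compat; lra.
  - exists N. specialize (HN N (Nat.le_refl N)).
    assert (Hp : 0 < (/ 2) ^ N) by (apply pow_lt; lra).
    rewrite Rabs_pos_eq in HN; [| lra].
    apply (Rmult_lt_compat_l (C + 1)) in HN; [| lra].
    replace ((C + 1) * (e / (C + 1))) with e in HN by (field; lra). lra.
Qed.

Lemma nonpos_of_le_mul_pow_half (C x : R) :
  (forall n, x <= C * (/ 2) ^ n) -> x <= 0.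
Proof.
  intros Hx. apply Rnot_lt_le. intros Hpos.
  assert (HC : 0 <= C) by (pose proof (Hx 0%nat); simpl in *; lra).
  destruct (exists_mul_pow_half_lt C x HC Hpos) as [N HN].
  specialize (Hx N). lra.
Qed.

Lemma exp_le_compat (x y : R) : x <= y -> exp x <= exp y.
Proof.
  intros [Hlt | ->]; [| apply Rle_refl].
  left. now apply exp_increasing.
Qed.

Lemma continuous_Rmax_l (c t : R) : continuous (fun s => Rmax s c) t.
Proof.
  apply filterlim_locally. intros e. exists e. intros s Hs.
  change (Rabs (Rmax s c - Rmax t c) < e). change (Rabs (s - t) < e) in Hs.
  revert Hs. unfold Rmax, Rabs.
  repeat destruct Rle_dec; repeat destruct Rcase_abs; lra.
Qed.

Lemma ex_RInt_continuous_everywhere (E : CompleteNormedModule R_AbsRing)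
    (phi : R -> E) (a b : R) :
  (forall t, continuous phi t) -> ex_RInt phi a b.
Proof. intros Hc. apply ex_RInt_continuous. auto. Qed.

Lemma is_derive_primitive (E : CompleteNormedModule R_AbsRing) (phi : R -> E)
    (u : E) (t0 t : R) :
  (forall s, continuous phi s) ->
  is_derive (fun b => plus u (RInt phi t0 b)) t (phi t).
Proof.
  intros Hc.
  rewrite -(plus_zero_l (phi t)).
  apply (is_derive_plus (K := R_AbsRing) (fun _ => u)).
  - exact (is_derive_const (V := E) u t).
  - apply is_derive_RInt with t0; [| apply Hc].
    apply filter_forall. intros b.
    now apply RInt_correct, ex_RInt_continuous_everywhere.
Qed.

Lemma norm_minus_primitive_le (E : CompleteNormedModule R_AbsRing)
    (phi psi : R -> E) (k : R -> R) (u : E) (a b I : R) :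
  (forall s, continuous phi s) -> (forall s, continuous psi s) -> a <= b ->
  (forall s, a <= s <= b -> norm (minus (phi s) (psi s)) <= k s) ->
  is_RInt k a b I ->
  norm (minus (plus u (RInt phi a b)) (plus u (RInt psi a b))) <= I.
Proof.
  intros Hphi Hpsi Hab Hk HI.
  replace (minus (plus u (RInt phi a b)) (plus u (RInt psi a b)))
    with (minus (RInt phi a b) (RInt psi a b)).
  - apply: (norm_RInt_le _ _ _ _ _ _ Hab Hk _ HI).
    apply: is_RInt_minus; now apply RInt_correct, ex_RInt_continuous_everywhere.
  - unfold minus. rewrite opp_plus (plus_comm u) -plus_assoc.
    rewrite (plus_assoc u) plus_opp_r plus_zero_l. reflexivity.
Qed.

Section Picard.

Variables (E : CompleteNormedModule R_AbsRing) (f : R -> E -> E).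
Variables (t0 : R) (u0 : E).

Hypothesis f_continuous : forall z : R -> E, (forall t, continuous z t) ->
  forall t, continuous (fun s => f s (z s)) t.
Hypothesis f_lipschitz : forall T, exists L, forall t a b, t0 <= t <= T ->
  norm (minus (f t a) (f t b)) <= L * norm (minus a b).

(** The clamp makes iterates constant to the left of [t0], hence continuous on the whole line, as
    [f_continuous] demands of its curves. *)
Definition picard_step (z : R -> E) (t : R) : E :=
  plus u0 (RInt (fun s => f s (z s)) t0 (Rmax t t0)).

Fixpoint picard_iter (n : nat) : R -> E :=
  match n with
  | O => fun _ => u0
  | S m => picard_step (picard_iter m)
  end.

Lemma picard_step_continuous (z : R -> E) :
  (forall t, continuous z t) -> forall t, continuous (picard_step z) t.
Proof.
  intros Hz t.
  apply (continuous_comp (fun s => Rmax s t0)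
    (fun b => plus u0 (RInt (fun s => f s (z s)) t0 b))).
  - apply continuous_Rmax_l.
  - apply: filterdiff_continuous. eexists.
    apply: (is_derive_primitive E (fun s => f s (z s))). auto.
Qed.

Lemma picard_iter_continuous (n : nat) : forall t, continuous (picard_iter n) t.
Proof.
  induction n as [| n IH].
  - intros t. apply continuous_const.
  - now apply picard_step_continuous.
Qed.

(* The factor [exp (2 L (t - t0))] is Bielecki's weight, which turns the
   integral operator into a contraction of ratio 1/2. *)
Lemma picard_iter_increment (T : R) : exists B, 0 <= B /\
  forall n t, t <= T ->
    norm (minus (picard_iter (S n) t) (picard_iter n t)) <= B * (/ 2) ^ n.
Proof.
  destruct (f_lipschitz T) as [L0 HL0].
  set (L := Rabs L0 + 1). assert (L_gt0 : 0 < L).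
  { pose proof (Rabs_pos L0). unfold L. lra. }
  assert (HL : forall t a b, t0 <= t <= T ->
    norm (minus (f t a) (f t b)) <= L * norm (minus a b)).
  { intros t a b Ht. eapply Rle_trans; [now apply HL0 |].
    apply Rmult_le_compat_r; [apply norm_ge_0 |].
    pose proof (Rle_abs L0). unfold L. lra. }
  destruct (bounded_continuity (fun t => minus (picard_iter 1 t) u0) t0
    (Rmax T t0)) as [M HM].
  { intros t _. apply: continuous_minus.
    - apply picard_iter_continuous.
    - apply continuous_const. }
  assert (M_ge0 : 0 <= M).
  { assert (Ht : t0 <= t0 <= Rmax T t0) by (split; [lra | apply Rmax_r]).
    specialize (HM t0 Ht). pose proof (norm_ge_0 (minus (picard_iter 1 t0) u0)).
    lra. }
  assert (Hn : forall n t, t <= T ->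
    norm (minus (picard_iter (S n) t) (picard_iter n t))
    <= M * (/ 2) ^ n * exp (2 * L * (Rmax t t0 - t0))).
  { induction n as [| n IH]; intros t Ht.
    - apply Rle_trans with (M * 1).
      + rewrite Rmult_1_r. left.
        assert (Hr : t0 <= Rmax t t0 <= Rmax T t0).
        { split; [apply Rmax_r | now apply Rle_max_compat_r]. }
        specialize (HM _ Hr). simpl in HM. unfold picard_step in HM.
        rewrite Rmax_left in HM; [exact HM | apply Rmax_r].
      + replace (M * (/ 2) ^ 0) with M by (simpl; ring).
        apply Rmult_le_compat_l; [exact M_ge0 |].
        rewrite -exp_0. apply exp_le_compat.
        pose proof (Rmax_r t t0). nra.
    - set (K := M * (/ 2) ^ S n).
      assert (K_ge0 : 0 <= K).
      { apply Rmult_le_pos; [exact M_ge0 | apply pow_le; lra]. }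
      destruct (Rle_dec t0 T) as [HT | HT].
      2:{ simpl. unfold picard_step. rewrite Rmax_right; [| lra].
          rewrite !RInt_point minus_eq_zero norm_zero.
          apply Rmult_le_pos; [exact K_ge0 | left; apply exp_pos]. }
      apply Rle_trans with (K * exp (2 * L * (Rmax t t0 - t0))
        - K * exp (2 * L * (t0 - t0))).
      + apply: (norm_minus_primitive_le E
          (fun s => f s (picard_iter (S n) s)) (fun s => f s (picard_iter n s))
          (fun s => K * (exp (2 * L * (s - t0)) * (2 * L)))).
        * apply f_continuous, picard_iter_continuous.
        * apply f_continuous, picard_iter_continuous.
        * apply Rmax_r.
        * intros s [Hs1 Hs2].
          assert (HsT : s <= T).
          { eapply Rle_trans; [exact Hs2 |]. now apply Rmax_lub. }
          eapply Rle_trans; [apply HL; lra |].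
          eapply Rle_trans; [apply Rmult_le_compat_l; [lra |]; now apply IH |].
          rewrite (Rmax_left s); [| lra]. right. unfold K. simpl. field.
        * apply: (is_RInt_derive (V := R_CompleteNormedModule)
            (fun s => K * exp (2 * L * (s - t0)))).
          -- intros s _. auto_derive; [trivial | unfold Rminus; ring].
          -- intros s _.
             apply (ex_derive_continuous
               (fun s => K * (exp (2 * L * (s - t0)) * (2 * L)))).
             auto_derive. trivial.
      + assert (0 < exp (2 * L * (t0 - t0))) by apply exp_pos. nra. }
  exists (M * exp (2 * L * (Rmax T t0 - t0))). split.
  - apply Rmult_le_pos; [exact M_ge0 | left; apply exp_pos].
  - intros n t Ht. eapply Rle_trans; [now apply Hn |].
    rewrite Rmult_assoc (Rmult_comm ((/ 2) ^ n)) -Rmult_assoc.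
    apply Rmult_le_compat_r; [apply pow_le; lra |].
    apply Rmult_le_compat_l; [exact M_ge0 |].
    apply exp_le_compat.
    assert (Rmax t t0 <= Rmax T t0) by now apply Rle_max_compat_r.
    nra.
Qed.

Lemma picard_iter_cauchy (T : R) : exists B, 0 <= B /\
  forall n k t, t <= T ->
    norm (minus (picard_iter (k + n) t) (picard_iter n t)) <= B * (/ 2) ^ n.
Proof.
  destruct (picard_iter_increment T) as [B [HB Hn]].
  exists (2 * B). split; [lra |].
  intros n k t Ht.
  (* Keeping the exact geometric sum, instead of its bound, lets the induction on [k] close. *)
  apply Rle_trans with (2 * B * (/ 2) ^ n * (1 - (/ 2) ^ k)).
  - induction k as [| k IH].
    + simpl. rewrite minus_eq_zero norm_zero. lra.
    + eapply Rle_trans;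
        [apply (norm_minus_triangle E _ (picard_iter (k + n) t)) |].
      pose proof (Hn (k + n)%nat t Ht) as Hk. rewrite pow_add in Hk.
      change (S k + n)%nat with (S (k + n)).
      assert (E1 : B * ((/ 2) ^ k * (/ 2) ^ n)
        + 2 * B * (/ 2) ^ n * (1 - (/ 2) ^ k)
        = 2 * B * (/ 2) ^ n * (1 - (/ 2) ^ S k)) by (simpl; field).
      rewrite -E1. apply Rplus_le_compat; [exact Hk | exact IH].
  - assert (0 <= (/ 2) ^ n) by (apply pow_le; lra).
    assert (0 <= (/ 2) ^ k) by (apply pow_le; lra).
    assert (0 <= 2 * B * (/ 2) ^ n) by (apply Rmult_le_pos; lra). nra.
Qed.

(** The limit is taken pointwise, so one [z] serves every [T]; only the constant [B] of the uniform
    convergence up to [T] depends on it. *)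
Lemma picard_iter_limit : exists z : R -> E, forall T, exists B, 0 <= B /\
  forall n t, t <= T -> norm (minus (picard_iter n t) (z t)) <= B * (/ 2) ^ n.
Proof.
  assert (Hlim : forall t, exists y, filterlim (fun n => picard_iter n t)
    eventually (locally y)).
  { intros t. apply (filterlim_locally_cauchy (U := E)). intros e.
    destruct (picard_iter_cauchy t) as [B [HB Hc]].
    assert (HB2 : 0 <= 2 * B) by lra.
    destruct (exists_mul_pow_half_lt _ _ HB2 (cond_pos e)) as [N Hs].
    exists (fun n => (N <= n)%nat). split; [now exists N |].
    intros n m Hn Hm.
    pose proof (Hc N (n - N)%nat t (Rle_refl t)) as Hn'.
    pose proof (Hc N (m - N)%nat t (Rle_refl t)) as Hm'.
    replace (n - N + N)%nat with n in Hn' by lia.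
    replace (m - N + N)%nat with m in Hm' by lia.
    apply: norm_compat1.
    change (norm (minus (picard_iter m t) (picard_iter n t)) < e).
    eapply Rle_lt_trans; [apply (norm_minus_triangle E _ (picard_iter N t)) |].
    rewrite (norm_minus_sym E (picard_iter N t)). lra. }
  exists (fun t => proj1_sig (constructive_indefinite_description _ (Hlim t))).
  intros T. destruct (picard_iter_cauchy T) as [B [HB Hc]].
  exists B. split; [exact HB |]. intros n t Ht.
  destruct constructive_indefinite_description as [y Hy]. simpl.
  apply le_epsilon. intros e He.
  destruct (Hy _ (locally_ball_norm y (mkposreal e He))) as [N HN].
  specialize (HN (N + n)%nat). unfold ball_norm in HN. simpl in HN.
  eapply Rle_trans; [apply (norm_minus_triangle E _ (picard_iter (N + n) t)) |].
  rewrite (norm_minus_sym E (picard_iter n t)).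
  apply Rplus_le_compat; [now apply Hc | left; apply HN; lia].
Qed.

Lemma picard_global : exists w : R -> E,
  w t0 = u0 /\ forall t, t0 <= t -> is_derive w t (f t (w t)).
Proof.
  destruct picard_iter_limit as [z Hz].
  assert (z_continuous : forall t, continuous z t).
  { intros t. destruct (Hz (t + 1)) as [B [HB HzB]].
    apply (filterlim_locally_ball_norm (U := E)). intros e.
    assert (HB4 : 0 <= 4 * B) by lra.
    destruct (exists_mul_pow_half_lt _ _ HB4 (cond_pos e)) as [N Hs].
    assert (He : 0 < e / 2) by (pose proof (cond_pos e); lra).
    assert (HcN : locally t (fun s =>
      norm (minus (picard_iter N s) (picard_iter N t)) < e / 2)).
    { exact (picard_iter_continuous N t _
        (locally_ball_norm (picard_iter N t) (mkposreal _ He))). }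
    assert (Hlt : locally t (fun s => s < t + 1)) by (apply open_lt; lra).
    generalize (filter_and _ _ HcN Hlt). apply filter_imp.
    intros s [Hs1 Hs2].
    change (norm (minus (z s) (z t)) < e).
    eapply Rle_lt_trans; [apply (norm_minus_triangle E _ (picard_iter N s)) |].
    pose proof (norm_minus_triangle E
      (picard_iter N s) (picard_iter N t) (z t)).
    pose proof (HzB N s (Rlt_le _ _ Hs2)) as Hzs.
    assert (Ht1 : t <= t + 1) by lra.
    pose proof (HzB N t Ht1).
    rewrite (norm_minus_sym E (z s)). lra. }
  assert (Hfix : forall t, z t = picard_step z t).
  (* Both terms of the triangle inequality through the iterate of rank n + 1 are O(2^-n): the first
     by convergence, the second by the Lipschitz bound under the integral. *)
  { intros t.
    assert (Hd : norm (minus (z t) (picard_step z t)) <= 0).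
    { destruct (Hz (Rmax t t0)) as [B [HB HzB]].
      destruct (f_lipschitz (Rmax t t0)) as [L HL].
      apply nonpos_of_le_mul_pow_half with
        (B + (Rmax t t0 - t0) * (Rabs L * B)). intros n.
      eapply Rle_trans;
        [apply (norm_minus_triangle E _ (picard_iter (S n) t)) |].
      rewrite Rmult_plus_distr_r. apply Rplus_le_compat.
      - rewrite norm_minus_sym. eapply Rle_trans; [apply HzB, Rmax_l |].
        simpl. assert (0 <= (/ 2) ^ n) by (apply pow_le; lra). nra.
      - apply: (norm_minus_primitive_le E
          (fun s => f s (picard_iter n s)) (fun s => f s (z s))
          (fun s => Rabs L * B * (/ 2) ^ n)).
        + apply f_continuous, picard_iter_continuous.
        + now apply f_continuous.
        + apply Rmax_r.
        + intros s Hs. eapply Rle_trans; [now apply HL |].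
          rewrite Rmult_assoc.
          apply Rle_trans with (Rabs L * norm (minus (picard_iter n s) (z s))).
          * apply Rmult_le_compat_r; [apply norm_ge_0 | apply Rle_abs].
          * apply Rmult_le_compat_l; [apply Rabs_pos | apply HzB, Hs].
        + replace ((Rmax t t0 - t0) * (Rabs L * B) * (/ 2) ^ n) with
            (scal (Rmax t t0 - t0) (Rabs L * B * (/ 2) ^ n))
            by (unfold scal; simpl; unfold mult; simpl; ring).
          apply: is_RInt_const. }
    apply (plus_reg_r (opp (picard_step z t))). rewrite plus_opp_r.
    refine (norm_eq_zero (minus (z t) (picard_step z t)) _).
    apply Rle_antisym; [exact Hd | apply norm_ge_0]. }
  (* The primitive without clamp replaces [z]: they agree from [t0] on, but [z] is constant before
     [t0] and may have a kink there, whereas the primitive is differentiable on both sides. *)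
  exists (fun t => plus u0 (RInt (fun s => f s (z s)) t0 t)). split.
  - now rewrite RInt_point plus_zero_r.
  - intros t Ht.
    replace (plus u0 (RInt (fun s => f s (z s)) t0 t)) with (z t).
    + apply (is_derive_primitive E (fun s => f s (z s))).
      now apply f_continuous.
    + rewrite Hfix. unfold picard_step. now rewrite Rmax_left.
Qed.

End Picard.

(** * The truncated system *)

Lemma norm_scal_le (V : CompleteNormedModule R_AbsRing) (a : R) (x : V) :
  norm (scal a x) <= Rabs a * norm x.
Proof. apply: norm_scal. Qed.

Definition radial_proj (H : Hilbert) (r : R) (x : H) : H :=
  scal (r / Rmax r (norm x)) x.

Lemma radial_factor_bounds (H : Hilbert) (r : R) (x : H) : 0 < r ->
  0 < r / Rmax r (norm x) <= 1.
Proof.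
  intros Hr. pose proof (Rmax_l r (norm x)) as Hm. split.
  - apply Rdiv_lt_0_compat; lra.
  - apply Rmult_le_reg_r with (Rmax r (norm x)); [lra |].
    unfold Rdiv. rewrite Rmult_assoc Rinv_l; lra.
Qed.

Lemma radial_proj_id (H : Hilbert) (r : R) (x : H) :
  0 < r -> norm x <= r -> radial_proj H r x = x.
Proof.
  intros Hr Hx. unfold radial_proj. rewrite Rmax_left; [| exact Hx].
  unfold Rdiv. rewrite Rinv_r; [| lra]. apply: scal_one.
Qed.

Lemma radial_proj_norm (H : Hilbert) (r : R) (x : H) :
  0 < r -> norm (radial_proj H r x) <= r.
Proof.
  intros Hr. pose proof (radial_factor_bounds H r x Hr) as Hf.
  eapply Rle_trans; [apply norm_scal_le |].
  rewrite Rabs_pos_eq; [| lra].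
  apply Rle_trans with (r / Rmax r (norm x) * Rmax r (norm x)).
  - apply Rmult_le_compat_l; [lra | apply Rmax_r].
  - right. field. pose proof (Rmax_l r (norm x)). lra.
Qed.

(** The 2 counts two terms, each at most |x - y|: the same factor applied to x - y, and the change
    of factor applied to y, where r <= [mx] and |y| <= [my] absorb the denominators. *)
Lemma radial_proj_lipschitz (H : Hilbert) (r : R) (x y : H) : 0 < r ->
  norm (minus (radial_proj H r x) (radial_proj H r y))
  <= 2 * norm (minus x y).
Proof.
  intros Hr.
  pose proof (radial_factor_bounds H r x Hr) as Hx.
  set (mx := Rmax r (norm x)) in *. set (my := Rmax r (norm y)).
  assert (r <= mx) by apply Rmax_l. assert (r <= my) by apply Rmax_l.
  assert (Hyy : norm y <= my) by apply Rmax_r.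
  pose proof (norm_ge_0 y) as Hy0.
  replace (minus (radial_proj H r x) (radial_proj H r y)) with
    (plus (scal (r / mx) (minus x y)) (scal (r / mx - r / my) y))
    by (unfold radial_proj; fold mx my; hilbert_ring).
  eapply Rle_trans; [apply: norm_triangle |].
  replace (2 * norm (minus x y)) with (norm (minus x y) + norm (minus x y))
    by ring.
  apply Rplus_le_compat; (eapply Rle_trans; [apply norm_scal_le |]).
  - rewrite Rabs_pos_eq; [| lra].
    rewrite -{2}(Rmult_1_l (norm (minus x y))).
    apply Rmult_le_compat_r; [apply norm_ge_0 | lra].
  - assert (Hmm : Rabs (my - mx) <= norm (minus x y)).
    { pose proof (norm_triangle_inv x y) as Ht.
      eapply Rle_trans; [| exact Ht].
      unfold mx, my, Rmax, Rabs.
      repeat destruct Rle_dec; repeat destruct Rcase_abs; lra. }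
    eapply Rle_trans; [| exact Hmm].
    replace (r / mx - r / my) with ((my - mx) * (r / (mx * my)))
      by (field; lra).
    rewrite Rabs_mult (Rabs_pos_eq (r / (mx * my))).
    + rewrite Rmult_assoc -{2}(Rmult_1_r (Rabs (my - mx))).
      apply Rmult_le_compat_l; [apply Rabs_pos |].
      apply Rmult_le_reg_r with (mx * my); [nra |].
      replace (r / (mx * my) * norm y * (mx * my)) with (r * norm y)
        by (field; lra).
      nra.
    + left. apply Rdiv_lt_0_compat; nra.
Qed.

Lemma continuous_pair (U V : NormedModule R_AbsRing) (a : R -> U) (b : R -> V)
    (t : R) :
  continuous a t -> continuous b t ->
  continuous (U := prod_UniformSpace U V) (fun s => (a s, b s)) t.
Proof.
  intros Ha Hb P [e He].
  assert (HB : locally t (fun s => ball (a t) e (a s) /\ ball (b t) e (b s))).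
  { apply filter_and;
      [exact (Ha _ (locally_ball _ e)) | exact (Hb _ (locally_ball _ e))]. }
  revert HB. unfold filtermap. apply filter_imp.
  intros s Hs. apply He. exact Hs.
Qed.

Lemma continuous_radial_proj (H : Hilbert) (r : R -> R) (x : R -> H) (t : R) :
  (forall s, 0 < r s) -> continuous r t -> continuous x t ->
  continuous (fun s => radial_proj H (r s) (x s)) t.
Proof.
  intros Hr Cr Cx. unfold radial_proj.
  apply: (continuous_scal (K := R_AbsRing)); [| exact Cx].
  assert (Cn : continuous (fun s => norm (x s)) t).
  { apply: continuous_comp; [exact Cx | apply: filterlim_norm]. }
  apply (continuous_mult (K := R_AbsRing)); [exact Cr |].
  apply (continuous_comp (fun s => Rmax (r s) (norm (x s))) Rinv).
  - apply continuous_ext with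
      (fun s => / 2 * (r s + norm (x s) + Rabs (r s - norm (x s)))).
    { intros s. unfold Rmax, Rabs.
      destruct Rle_dec; destruct Rcase_abs; simpl in *; lra. }
    apply (continuous_mult (K := R_AbsRing)); [apply continuous_const |].
    apply: (continuous_plus (K := R_AbsRing) (V := R_NormedModule)).
    + now apply: (continuous_plus (K := R_AbsRing) (V := R_NormedModule)).
    + apply (continuous_comp (fun s => r s - norm (x s)) Rabs).
      * now apply: (continuous_minus (K := R_AbsRing) (V := R_NormedModule)).
      * apply continuous_Rabs.
  - apply continuous_Rinv.
    pose proof (Hr t). pose proof (Rmax_l (r t) (norm (x t))). lra.
Qed.

(* Time is clamped at [t0] so that the field is continuous on the whole line. *)
Definition truncated_field (H : Hilbert) (G : H -> H) (eps : R -> R)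
    (alpha beta t0 : R) (r : R -> R) (t : R) (z : H * H) : H * H :=
  let tau := Rmax t t0 in
  let gx := G (radial_proj H (r tau) (fst z)) in
  let v := minus (snd z) (scal beta gx) in
  (v, opp (plus (scal (alpha / tau) v)
             (plus gx (scal (eps tau) (fst z))))).

Lemma truncated_field_continuous (H : Hilbert) (G : H -> H) (eps : R -> R)
    (alpha beta t0 : R) (r : R -> R) :
  0 < t0 -> (forall x, continuous G x) ->
  continuous_on_half_line (V := R_NormedModule) t0 eps ->
  (forall t, t0 <= t -> 0 < r t) -> (forall t, continuous r t) ->
  forall z : R -> prod_CompleteNormedModule R_AbsRing H H,
  (forall t, continuous z t) -> forall t,
  continuous (U := prod_CompleteNormedModule R_AbsRing H H)
    (fun s => truncated_field H G eps alpha beta t0 r s (z s)) t.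
Proof.
  intros Ht0 CG Ceps Hr Cr z Cz t.
  assert (Cfst : continuous (fun s => fst (z s)) t).
  { apply (continuous_comp z (fun p : H * H => fst p)); [apply Cz |].
    apply: continuous_fst. }
  assert (Csnd : continuous (fun s => snd (z s)) t).
  { apply (continuous_comp z (fun p : H * H => snd p)); [apply Cz |].
    apply: continuous_snd. }
  assert (Cg : continuous
    (fun s => G (radial_proj H (r (Rmax s t0)) (fst (z s)))) t).
  { apply: continuous_comp; [| apply CG].
    apply: (continuous_radial_proj H (fun s => r (Rmax s t0))).
    - intros s. apply Hr, Rmax_r.
    - apply (continuous_comp (fun s => Rmax s t0) r);
        [apply continuous_Rmax_l | apply Cr].
    - exact Cfst. }
  assert (Cv : continuous (fun s => minus (snd (z s))
    (scal beta (G (radial_proj H (r (Rmax s t0)) (fst (z s)))))) t).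
  { apply: continuous_minus; [exact Csnd |].
    apply: (continuous_scal (K := R_AbsRing));
      [apply continuous_const | exact Cg]. }
  apply: continuous_pair; [exact Cv |].
  apply: continuous_opp. apply: continuous_plus.
  - apply: (continuous_scal (K := R_AbsRing)); [| exact Cv].
    apply (continuous_mult (K := R_AbsRing)); [apply continuous_const |].
    apply (continuous_comp (fun s => Rmax s t0) Rinv);
      [apply continuous_Rmax_l | apply continuous_Rinv].
    pose proof (Rmax_r t t0). lra.
  - apply: continuous_plus; [exact Cg |].
    apply: (continuous_scal (K := R_AbsRing)); [| exact Cfst].
    apply (continuous_clamp R_NormedModule). apply Ceps, Rmax_r.
Qed.

(** Up to time [T] all projected points lie in the ball of radius [r T], so one Lipschitz constant
    of [G] serves; [alpha / t] and [eps t] are largest at [t0]. *)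
Lemma truncated_field_lipschitz (H : Hilbert) (G : H -> H) (eps : R -> R)
    (alpha beta t0 : R) (r : R -> R) :
  0 < t0 -> 0 <= alpha -> 0 <= beta -> lipschitz_on_bounded_sets G ->
  (forall t, t0 <= t -> 0 <= eps t <= eps t0) ->
  (forall s t, t0 <= s <= t -> 0 < r s <= r t) ->
  forall T, exists L, forall t (a b : prod_CompleteNormedModule R_AbsRing H H),
    t0 <= t <= T ->
    norm (minus (truncated_field H G eps alpha beta t0 r t a :
                   prod_CompleteNormedModule R_AbsRing H H)
                (truncated_field H G eps alpha beta t0 r t b))
    <= L * norm (minus a b).
Proof.
  intros Ht0 Ha Hb HG Heps Hr T.
  destruct (HG (fun x => norm x <= r T)) as [L0 HL0]; [now exists (r T) |].
  set (L := Rabs L0).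
  assert (L_ge0 : 0 <= L) by apply Rabs_pos.
  set (L1 := 1 + beta * (L * 2)).
  set (A := alpha / t0).
  assert (A_ge0 : 0 <= A) by (apply Rdiv_le_0_compat; lra).
  exists (L1 + (A * L1 + (L * 2 + eps t0))).
  intros t a b Ht.
  set (da := norm (minus (fst a) (fst b))).
  set (db := norm (minus (snd a) (snd b))).
  set (d := norm (minus a b)).
  assert (Hda : da <= d) by apply (proj1 (norm_prod_ge H H (minus a b))).
  assert (Hdb : db <= d) by apply (proj2 (norm_prod_ge H H (minus a b))).
  assert (d_ge0 : 0 <= d) by apply norm_ge_0.
  unfold truncated_field. rewrite Rmax_left; [| lra].
  destruct (Hr t T Ht) as [Hrt HrT].
  set (ga := G (radial_proj H (r t) (fst a))).
  set (gb := G (radial_proj H (r t) (fst b))).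
  assert (Hg : norm (minus ga gb) <= L * 2 * d).
  { apply Rle_trans with (L * (2 * da)).
    - apply Rle_trans with (L * norm (minus (radial_proj H (r t) (fst a))
        (radial_proj H (r t) (fst b)))).
      + eapply Rle_trans; [apply HL0 |].
        * now apply Rle_trans with (r t); [apply radial_proj_norm |].
        * now apply Rle_trans with (r t); [apply radial_proj_norm |].
        * apply Rmult_le_compat_r; [apply norm_ge_0 | apply Rle_abs].
      + apply Rmult_le_compat_l; [exact L_ge0 |].
        now apply radial_proj_lipschitz.
    - nra. }
  set (va := minus (snd a) (scal beta ga)).
  set (vb := minus (snd b) (scal beta gb)).
  assert (Hv : norm (minus va vb) <= L1 * d).
  { replace (minus va vb) with
      (plus (minus (snd a) (snd b)) (scal (- beta) (minus ga gb)))
      by (unfold va, vb; hilbert_ring).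
    eapply Rle_trans; [apply: norm_triangle |].
    apply Rle_trans with (d + beta * (L * 2 * d)); [| unfold L1; right; ring].
    apply Rplus_le_compat; [exact Hdb |].
    eapply Rle_trans; [apply norm_scal_le |].
    rewrite Rabs_Ropp Rabs_pos_eq; [| exact Hb].
    now apply Rmult_le_compat_l. }
  eapply Rle_trans; [apply: norm_prod_le |].
  apply Rle_trans with (L1 * d + (A * (L1 * d) + (L * 2 * d + eps t0 * d)));
    [| right; ring].
  apply Rplus_le_compat; [exact Hv |].
  set (force := fun v G x : H =>
    opp (plus (scal (alpha / t) v) (plus G (scal (eps t) x)))).
  change (norm (minus (force va ga (fst a)) (force vb gb (fst b)))
    <= A * (L1 * d) + (L * 2 * d + eps t0 * d)).
  replace (minus (force va ga (fst a)) (force vb gb (fst b)))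
    with (opp (plus (scal (alpha / t) (minus va vb))
      (plus (minus ga gb) (scal (eps t) (minus (fst a) (fst b))))))
    by (unfold force; hilbert_ring).
  rewrite norm_opp.
  eapply Rle_trans; [apply: norm_triangle |].
  apply Rplus_le_compat.
  - eapply Rle_trans; [apply norm_scal_le |].
    assert (HAt : 0 <= alpha / t <= A).
    { split; [apply Rdiv_le_0_compat; lra |].
      apply Rmult_le_compat_l; [exact Ha |]. apply Rinv_le_contravar; lra. }
    rewrite Rabs_pos_eq; [| lra].
    apply Rmult_le_compat; [lra | apply norm_ge_0 | lra | exact Hv].
  - eapply Rle_trans; [apply: norm_triangle |].
    apply Rplus_le_compat; [exact Hg |].
    eapply Rle_trans; [apply norm_scal_le |].
    destruct (Heps t (proj1 Ht)) as [He1 He2].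
    rewrite Rabs_pos_eq; [| exact He1].
    apply Rmult_le_compat;
      [exact He1 | apply norm_ge_0 | exact He2 | exact Hda].
Qed.

(** * Energy estimate and existence *)

Lemma nonincreasing_derivative_nonpos (t0 t l : R) (f : R -> R) :
  t0 <= t ->
  filterdiff (V := R_NormedModule) f (half_line_at t0 t)
    (fun h : R => scal h l) ->
  (forall s, t <= s -> f s <= f t) -> l <= 0.
Proof.
  intros Ht Hf Hs.
  apply (derivative_le t0 t 1 0 l f Ht Rlt_0_1 Hf).
  intros s Hs'. assert (f s <= f t) by (apply Hs; lra). lra.
Qed.

(** Pairing the equation with v shows that the energy has derivative -(alpha / t) |v|^2 - beta
    <Hessian v, v> + (eps' / 2) |x|^2. The equation is assumed only up to [T], because the truncated
    trajectory satisfies it only as long as it is confined. *)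
Lemma velocity_bound (H : Hilbert) (g : H -> R) (eps eps' : R -> R)
    (alpha beta t0 T : R) (z : H) (x v a : R -> H) :
  convex g -> twice_frechet_differentiable g -> argmin g z ->
  (forall t, t0 <= t -> 0 <= eps t) ->
  (forall s t, t0 <= s -> s <= t -> eps t <= eps s) ->
  derivative_on (V := R_NormedModule) t0 eps eps' ->
  0 <= alpha -> 0 <= beta -> 0 < t0 -> t0 <= T ->
  (forall t, t0 <= t <= T ->
    filterdiff x (half_line_at t0 t) (fun h : R => scal h (v t))) ->
  (forall t, t0 <= t <= T ->
    filterdiff v (half_line_at t0 t) (fun h : R => scal h (a t))) ->
  (forall t, t0 <= t <= T ->
     plus (a t)
       (plus (scal (alpha / t) (v t))
          (plus (scal beta (hessian g (x t) (v t)))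
             (plus (gradient g (x t)) (scal (eps t) (x t))))) = zero) ->
  norm (v T) * norm (v T) <= 2 * (g (x t0) - g z)
    + norm (v t0) * norm (v t0) + eps t0 * (norm (x t0) * norm (x t0)).
Proof.
  intros Hc Hd Hz Heps0 Heps Deps Ha Hb Ht0 HT Dx Dv Hode.
  set (f := fun s => g (x s) + (/ 2 * inner (v s) (v s)
    + / 2 * (eps s * inner (x s) (x s)))).
  set (f' := fun s => inner (gradient g (x s)) (v s)
    + (/ 2 * (inner (a s) (v s) + inner (v s) (a s))
    + / 2 * (eps' s * inner (x s) (x s)
              + eps s * (inner (v s) (x s) + inner (x s) (v s))))).
  assert (Hf : f T <= f t0).
  { apply (nonincreasing_of_derivative_nonpos t0 T f f' HT).
    - intros t Ht. destruct Ht as [Ht1 Ht2].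
      pose proof (Dx t (conj Ht1 Ht2)) as Dxt.
      pose proof (Dv t (conj Ht1 Ht2)) as Dvt.
      apply: (half_line_plus R_NormedModule); [| | exact Ht1].
      + apply: (half_line_comp H R_NormedModule t0 t x (v t)) Dxt _ Ht1.
        apply gradient_spec, Hd.
      + apply: (half_line_plus R_NormedModule); [| | exact Ht1].
        * apply: (half_line_scal R_NormedModule); [| exact Ht1].
          now apply half_line_inner.
        * apply: (half_line_scal R_NormedModule); [| exact Ht1].
          apply half_line_mult; [now apply Deps | | exact Ht1].
          now apply half_line_inner.
    - intros t Ht.
      assert (Heps' : eps' t <= 0).
      { apply (nonincreasing_derivative_nonpos t0 t _ eps); [lra | |].
        - apply Deps. lra.
        - intros s Hs. apply Heps; lra. }
      pose proof (hessian_nonneg H g (x t) (v t) Hc Hd) as Hh.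
      pose proof (f_equal (fun y => inner y (v t)) (Hode t Ht)) as E.
      revert E. simpl. inner_expand. intros E.
      unfold f'. rewrite (inner_sym (v t) (a t)) (inner_sym (v t) (x t)).
      pose proof (inner_ge_0 (x t)) as Hxx.
      pose proof (inner_ge_0 (v t)) as Hvv.
      assert (Hat : 0 <= alpha / t) by (apply Rdiv_le_0_compat; lra).
      assert (0 <= alpha / t * inner (v t) (v t)) by now apply Rmult_le_pos.
      assert (0 <= beta * inner (hessian g (x t) (v t)) (v t))
        by now apply Rmult_le_pos.
      assert (0 <= - eps' t * inner (x t) (x t)) by (apply Rmult_le_pos; lra).
      lra. }
  revert Hf. unfold f. rewrite -!norm_sqr.
  pose proof (Hz (x T)) as HzT.
  assert (0 <= eps T * (norm (x T) * norm (x T))).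
  { apply Rmult_le_pos; [now apply Heps0 | apply Rle_0_sqr]. }
  lra.
Qed.

Lemma norm_le_of_sqr_le (a b : R) : 0 <= a -> a * a <= b -> a <= sqrt b.
Proof.
  intros Ha Hab. rewrite -(sqrt_square a Ha). now apply sqrt_le_1_alt.
Qed.

(** A vector-valued mean value inequality, reduced to a scalar one by testing against the
    displacement [k] itself: <x(s), k> - C |k| s is nonincreasing. *)
Lemma displacement_le (H : Hilbert) (t0 T C : R) (x v : R -> H) :
  t0 <= T ->
  (forall t, t0 <= t <= T ->
    filterdiff x (half_line_at t0 t) (fun h : R => scal h (v t))) ->
  (forall t, t0 <= t <= T -> norm (v t) <= C) ->
  norm (minus (x T) (x t0)) <= C * (T - t0).
Proof.
  intros HT Dx Hv.
  set (k := minus (x T) (x t0)).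
  pose proof (norm_ge_0 k) as Hk.
  assert (Hf : inner (x T) k - C * norm k * T
    <= inner (x t0) k - C * norm k * t0).
  { apply (nonincreasing_of_derivative_nonpos t0 T
      (fun s => inner (x s) k - C * norm k * s)
      (fun s => (inner (v s) k + inner (x s) zero) - C * norm k * 1) HT).
    - intros t Ht.
      apply: (half_line_minus R_NormedModule); [| | apply Ht].
      + apply half_line_inner; [now apply Dx | | apply Ht].
        apply: half_line_of_is_derive; [| apply Ht].
        exact (is_derive_const (V := H) k t).
      + apply: (half_line_scal R_NormedModule); [| apply Ht].
        apply: half_line_of_is_derive; [| apply Ht].
        exact (is_derive_id (K := R_AbsRing) t).
    - intros t Ht. rewrite inner_zero_r.
      pose proof (cauchy_schwarz_le H (v t) k) as Hvk.
      assert (norm (v t) * norm k <= C * norm k)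
        by (apply Rmult_le_compat_r; [exact Hk | now apply Hv]).
      lra. }
  assert (Hkk : norm k * norm k <= C * (T - t0) * norm k).
  { rewrite norm_sqr {1}/k inner_minus_l. lra. }
  destruct Hk as [Hk | Hk].
  - now apply Rmult_le_reg_r with (norm k).
  - rewrite -Hk. apply Rmult_le_pos; [| lra].
    apply Rle_trans with (norm (v t0)); [apply norm_ge_0 | apply Hv; lra].
Qed.

(** At the supremum of the times up to which [d] stays nonnegative, the strict inequality and
    continuity would carry [d] further. *)
Lemma continuous_induction (d : R -> R) (t0 : R) :
  (forall t, continuous d t) -> 0 <= d t0 ->
  (forall t, t0 <= t -> (forall s, t0 <= s <= t -> 0 <= d s) -> 0 < d t) ->
  forall t, t0 <= t -> 0 <= d t.
Proof.
  intros Cd H0 Hstep T HT.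
  apply Rnot_lt_le. intros HdT.
  set (S := fun t => t0 <= t /\ forall s, t0 <= s <= t -> 0 <= d s).
  destruct (completeness S) as [m [Hub Hlub]].
  { exists T. intros t [Ht Hs]. apply Rnot_lt_le. intros HTt.
    assert (0 <= d T) by (apply Hs; lra). lra. }
  { exists t0. split; [lra |].
    intros s Hs. replace s with t0 by lra. exact H0. }
  assert (Hm0 : t0 <= m).
  { apply Hub. split; [lra |].
    intros s Hs. replace s with t0 by lra. exact H0. }
  assert (Hbelow : forall s, t0 <= s < m -> 0 <= d s).
  { intros s Hs. apply NNPP. intros Hds.
    assert (m <= s); [| lra].
    apply Hlub. intros t [Ht Hst]. apply Rnot_lt_le. intros Hlt.
    apply Hds, Hst. lra. }
  assert (Hdm : 0 <= d m).
  { apply Rnot_lt_le. intros Hneg.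
    destruct (Cd m (fun y => y < 0) (open_lt 0 (d m) Hneg)) as [e He].
    destruct (Req_dec m t0) as [-> | Hne]; [lra |].
    set (s := Rmax t0 (m - e / 2)). pose proof (cond_pos e).
    assert (Hs : t0 <= s < m /\ m - e < s).
    { unfold s, Rmax. destruct Rle_dec; lra. }
    assert (d s < 0).
    { apply He. change (Rabs (s - m) < e). rewrite Rabs_left; lra. }
    assert (0 <= d s) by now apply Hbelow. lra. }
  assert (Hall : forall s, t0 <= s <= m -> 0 <= d s).
  { intros s Hs. destruct (Req_dec s m) as [-> | Hne]; [exact Hdm |].
    apply Hbelow. lra. }
  pose proof (Hstep m Hm0 Hall) as Hpos.
  destruct (Cd m (fun y => 0 < y) (open_gt 0 (d m) Hpos)) as [e He].
  pose proof (cond_pos e).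
  assert (m + e / 2 <= m); [| lra].
  apply Hub. split; [lra |]. intros s Hs.
  destruct (Rle_dec s m) as [Hsm | Hsm]; [apply Hall; lra |].
  left. apply He. change (Rabs (s - m) < e). rewrite Rabs_pos_eq; lra.
Qed.

Lemma half_line_continuous_bounded (V : NormedModule R_AbsRing) (t0 T : R)
    (f : R -> V) :
  continuous_on_half_line t0 f ->
  exists M, forall t, t0 <= t <= T -> norm (f t) <= M.
Proof.
  intros Cf.
  destruct (bounded_continuity (fun s => f (Rmax s t0)) t0 T) as [M HM].
  { intros t Ht. apply (continuous_clamp V t0 t f). apply Cf, Rmax_r. }
  exists M. intros t Ht. specialize (HM t Ht).
  rewrite Rmax_left in HM; lra.
Qed.

Lemma derivative_on_continuous (V : NormedModule R_AbsRing) (t0 : R)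
    (f f' : R -> V) :
  derivative_on t0 f f' -> continuous_on_half_line t0 f.
Proof.
  intros Df t Ht. apply: filterdiff_half_line_continuous. now apply Df.
Qed.

Section Cauchy_problem.

Variables (H : Hilbert) (g : H -> R) (eps : R -> R) (alpha beta t0 : R).

Hypothesis g_convex : convex g.
Hypothesis g_diff2 : twice_frechet_differentiable g.
Hypothesis grad_lip : lipschitz_on_bounded_sets (gradient g).
Hypothesis g_argmin : exists z : H, argmin g z.
Hypothesis eps_ge0 : forall t : R, t0 <= t -> 0 <= eps t.
Hypothesis eps_noninc : forall s t : R, t0 <= s -> s <= t -> eps t <= eps s.
Hypothesis eps_C1 : C1_on_half_line t0 eps.
Hypothesis alpha_ge0 : 0 <= alpha.
Hypothesis beta_ge0 : 0 <= beta.
Hypothesis t0_gt0 : 0 < t0.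

(** Here the Hessian re-enters: a solution of the first-order system is differentiable once more
    because the gradient is differentiable. *)
Lemma half_line_velocity (x y : R -> H) (y' : H) (t : R) : t0 <= t ->
  let v := fun s => minus (y s) (scal beta (gradient g (x s))) in
  filterdiff x (half_line_at t0 t) (fun h : R => scal h (v t)) ->
  filterdiff y (half_line_at t0 t) (fun h : R => scal h y') ->
  filterdiff v (half_line_at t0 t)
    (fun h : R => scal h (minus y' (scal beta (hessian g (x t) (v t))))).
Proof.
  intros Ht v Dx Dy.
  apply: half_line_minus; [exact Dy | | exact Ht].
  apply: half_line_scal; [| exact Ht].
  apply: (half_line_comp H H t0 t x (v t) _ _ Dx _ Ht).
  apply hessian_spec, g_diff2.
Qed.

Definition acceleration (x v : R -> H) (t : R) : H :=
  opp (plus (scal (alpha / t) (v t))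
    (plus (scal beta (hessian g (x t) (v t)))
      (plus (gradient g (x t)) (scal (eps t) (x t))))).

Lemma solution_exists (u0 v0 : H) : exists x v : R -> H,
  solution g eps alpha beta t0 u0 v0 x v (acceleration x v).
Proof.
  destruct g_argmin as [z Hz].
  destruct eps_C1 as [eps' [Deps _]].
  (* The right-hand side of [velocity_bound] for the initial data; its square root [C] bounds the
     speed. *)
  set (K := 2 * (g u0 - g z) + norm v0 * norm v0
    + eps t0 * (norm u0 * norm u0)).
  set (C := sqrt K).
  assert (C_ge0 : 0 <= C) by apply sqrt_pos.
  set (r := fun t => norm u0 + 1 + C * (t - t0)).
  pose proof (norm_ge_0 u0) as Hu0.
  assert (r_pos : forall t, t0 <= t -> 0 < r t).
  { intros t Ht. unfold r.
    assert (0 <= C * (t - t0)) by (apply Rmult_le_pos; lra). lra. }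
  assert (r_cont : forall t, continuous r t).
  { intros t. apply (ex_derive_continuous r). unfold r. auto_derive. trivial. }
  assert (CG : forall y, continuous (gradient g) y).
  { intros y. apply: filterdiff_continuous. apply g_diff2. }
  destruct (picard_global (prod_CompleteNormedModule R_AbsRing H H)
    (truncated_field H (gradient g) eps alpha beta t0 r) t0
    (u0, plus v0 (scal beta (gradient g u0)))) as [w [w0 Dw]].
  { apply truncated_field_continuous; try assumption.
    now apply derivative_on_continuous with eps'. }
  { apply truncated_field_lipschitz; try assumption.
    - intros t Ht. split; [now apply eps_ge0 | apply eps_noninc; lra].
    - intros s t Hst. split; [apply r_pos; lra |]. unfold r.
      apply Rplus_le_compat_l, Rmult_le_compat_l; lra. }
  set (x := fun t => fst (w t)). set (y := fun t => snd (w t)).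
  set (v := fun s => minus (y s) (scal beta (gradient g (x s)))).
  assert (x0 : x t0 = u0) by (unfold x; now rewrite w0).
  assert (v0E : v t0 = v0) by (unfold v, y, x; rewrite w0; simpl; hilbert_ring).
  (* The truncated and the original equations agree at each single time when |x| <= r, since the
     projection fixes that point; no information on other times enters. *)
  assert (Dx : forall t, t0 <= t -> norm (x t) <= r t ->
    filterdiff x (half_line_at t0 t) (fun h : R => scal h (v t))).
  { intros t Ht Hxt.
    pose proof (half_line_comp _ _ t0 t w _
      (fun p : H * H => fst p) (fun p : H * H => fst p)
      (half_line_of_is_derive _ t0 t w _ (Dw t Ht) Ht)
      (filterdiff_linear _ is_linear_fst) Ht) as D.
    simpl in D. rewrite Rmax_left in D; [| exact Ht].
    change (fst (w t)) with (x t) in D.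
    rewrite radial_proj_id in D; [exact D | now apply r_pos | exact Hxt]. }
  assert (Dy : forall t, t0 <= t -> norm (x t) <= r t ->
    filterdiff y (half_line_at t0 t) (fun h : R => scal h
      (opp (plus (scal (alpha / t) (v t))
        (plus (gradient g (x t)) (scal (eps t) (x t))))))).
  { intros t Ht Hxt.
    pose proof (half_line_comp _ _ t0 t w _
      (fun p : H * H => snd p) (fun p : H * H => snd p)
      (half_line_of_is_derive _ t0 t w _ (Dw t Ht) Ht)
      (filterdiff_linear _ is_linear_snd) Ht) as D.
    simpl in D. rewrite Rmax_left in D; [| exact Ht].
    change (fst (w t)) with (x t) in D.
    rewrite radial_proj_id in D; [exact D | now apply r_pos | exact Hxt]. }
  assert (Dv : forall t, t0 <= t -> norm (x t) <= r t ->
    filterdiff v (half_line_at t0 t)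
      (fun h : R => scal h (acceleration x v t))).
  { intros t Ht Hxt.
    pose proof (half_line_velocity x y _ t Ht (Dx t Ht Hxt) (Dy t Ht Hxt)) as D.
    fold v in D.
    replace (acceleration x v t) with (minus
      (opp (plus (scal (alpha / t) (v t))
        (plus (gradient g (x t)) (scal (eps t) (x t)))))
      (scal beta (hessian g (x t) (v t))))
      by (unfold acceleration; hilbert_ring).
    exact D. }
  assert (Hode : forall t, plus (acceleration x v t)
    (plus (scal (alpha / t) (v t))
      (plus (scal beta (hessian g (x t) (v t)))
        (plus (gradient g (x t)) (scal (eps t) (x t))))) = zero)
    by (intros t; apply: plus_opp_l).
  (* Bootstrap: confinement on [t0, t] makes the energy bound available there, hence |x(t)| <= |u0|
     + C (t - t0) = r(t) - 1. The clamp is present because [x] is controlled only from [t0] on. *)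
  assert (Htrap : forall t, t0 <= t -> norm (x t) <= r t).
  { intros t Ht.
    assert (Hd : 0 <= r (Rmax t t0) - norm (x (Rmax t t0))).
    { revert t Ht. apply (continuous_induction
        (fun t => r (Rmax t t0) - norm (x (Rmax t t0))) t0).
      - intros t.
        apply: (continuous_minus (K := R_AbsRing) (V := R_NormedModule)).
        + apply (continuous_comp (fun s => Rmax s t0) r);
            [apply continuous_Rmax_l | apply r_cont].
        + apply (continuous_comp (fun s => x (Rmax s t0)) norm);
            [| apply: filterlim_norm].
          apply (continuous_clamp H t0 t x).
          apply: filterdiff_half_line_continuous.
          apply (half_line_comp _ _ t0 (Rmax t t0) w _
            (fun p : H * H => fst p) (fun p : H * H => fst p)
            (half_line_of_is_derive _ t0 _ w _ (Dw _ (Rmax_r t t0))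
              (Rmax_r t t0))
            (filterdiff_linear _ is_linear_fst) (Rmax_r t t0)).
      - rewrite Rmax_left; [| lra]. rewrite x0. unfold r. lra.
      - intros t Ht Hs. rewrite Rmax_left; [| exact Ht].
        assert (Hr : forall s, t0 <= s <= t -> norm (x s) <= r s).
        { intros s Hst. specialize (Hs s Hst).
          rewrite Rmax_left in Hs; lra. }
        assert (Hdisp : norm (minus (x t) (x t0)) <= C * (t - t0)).
        { apply displacement_le with v; [exact Ht | |].
          - intros s Hst. apply Dx; [lra | now apply Hr].
          - intros s Hst. apply norm_le_of_sqr_le; [apply norm_ge_0 |].
            unfold K. rewrite -x0 -v0E.
            apply (velocity_bound H g eps eps' alpha beta t0 s z x v
              (acceleration x v)); try assumption; try lra.
            + intros s' Hs'. apply Dx; [lra | apply Hr; lra].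
            + intros s' Hs'. apply Dv; [lra | apply Hr; lra].
            + intros s' _. apply Hode. }
        assert (Hx : norm (x t) <= norm (minus (x t) (x t0)) + norm (x t0)).
        { replace (x t) with (plus (minus (x t) (x t0)) (x t0)) at 1
            by hilbert_ring.
          apply: norm_triangle. }
        rewrite x0 in Hx, Hdisp. unfold r. lra. }
    rewrite Rmax_left in Hd; lra. }
  exists x, v.
  refine (conj _ (conj _ (conj _ (conj x0 v0E)))).
  - intros t Ht. now apply Dx, Htrap.
  - intros t Ht. now apply Dv, Htrap.
  - intros t _. apply Hode.
Qed.

(** * Uniqueness and regularity *)

Lemma gradient_lipschitz_ball (r : R) : exists L, 0 <= L /\
  forall y z : H, norm y <= r -> norm z <= r ->
    norm (minus (gradient g y) (gradient g z)) <= L * norm (minus y z).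
Proof.
  destruct (grad_lip (fun y => norm y <= r)) as [L HL]; [now exists r |].
  exists (Rabs L). split; [apply Rabs_pos |].
  intros y z Hy Hz. eapply Rle_trans; [now apply HL |].
  apply Rmult_le_compat_r; [apply norm_ge_0 | apply Rle_abs].
Qed.

(** The converse of the reduction, needed for arbitrary solutions: the Hessian produced by the chain
    rule cancels the one in the equation. *)
Lemma half_line_momentum (u0 v0 : H) (x v a : R -> H) (t : R) :
  solution g eps alpha beta t0 u0 v0 x v a -> t0 <= t ->
  filterdiff (fun s => plus (v s) (scal beta (gradient g (x s))))
    (half_line_at t0 t)
    (fun h : R => scal h (opp (plus (scal (alpha / t) (v t))
        (plus (gradient g (x t)) (scal (eps t) (x t)))))).
Proof.
  intros [Dx [Dv [Hode _]]] Ht.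
  replace (opp (plus (scal (alpha / t) (v t))
        (plus (gradient g (x t)) (scal (eps t) (x t)))))
    with (plus (a t) (scal beta (hessian g (x t) (v t)))).
  - apply: half_line_plus; [now apply Dv | | exact Ht].
    apply: half_line_scal; [| exact Ht].
    apply: (half_line_comp H H t0 t x (v t) _ _ (Dx t Ht) _ Ht).
    apply hessian_spec, g_diff2.
  - apply inner_ext. intros h.
    pose proof (f_equal (fun y => inner y h) (Hode t Ht)) as E.
    revert E. simpl. inner_expand. lra.
Qed.

(** Algebraic core of the Gronwall estimate: [d], [q], [G] stand for the differences of positions,
    momenta and gradients, [c] for alpha / t and [e] for eps(t). The damping term -2 c |q|^2 is
    dropped by its sign, -2 beta <G, d> gives 2 beta L |d|^2, and every other term is a multiple of
    2 |d| |q| <= |d|^2 + |q|^2. *)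
Lemma momentum_inner_le (d q G : H) (L c A e B : R) :
  0 <= L -> 0 <= c <= A -> 0 <= e <= B -> norm G <= L * norm d ->
  2 * inner (minus q (scal beta G)) d
  + 2 * inner (opp (plus (scal c (minus q (scal beta G)))
                      (plus G (scal e d)))) q
  <= (1 + 2 * (beta * L) + (A * beta * L + L + B)) * (inner d d + inner q q).
Proof.
  intros HL0 Hc He HG.
  rewrite -(norm_sqr H d) -(norm_sqr H q). inner_expand.
  rewrite -(norm_sqr H q).
  pose proof (cauchy_schwarz H q d) as Hqd.
  pose proof (cauchy_schwarz H d q) as Hdq.
  pose proof (cauchy_schwarz H G d) as HGd.
  pose proof (cauchy_schwarz H G q) as HGq.
  pose proof (norm_ge_0 d) as Hnd. pose proof (norm_ge_0 q) as Hnq.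
  set (nd := norm d) in *. set (nq := norm q) in *.
  assert (HGd' : norm G * nd <= L * nd * nd) by now apply Rmult_le_compat_r.
  assert (HGq' : norm G * nq <= L * nd * nq) by now apply Rmult_le_compat_r.
  apply Rabs_le_between in Hqd, Hdq, HGd, HGq.
  set (iqd := inner q d) in *. set (idq := inner d q) in *.
  set (iGd := inner G d) in *. set (iGq := inner G q) in *.
  assert (Hm : 0 <= nd * nq) by now apply Rmult_le_pos.
  assert (H1 : - (beta * iGd) <= beta * (L * nd * nd)).
  { rewrite -Ropp_mult_distr_r_reverse. apply Rmult_le_compat_l; lra. }
  assert (H2 : c * (beta * iGq) <= A * (beta * (L * nd * nq))).
  { apply Rle_trans with (c * (beta * (L * nd * nq))).
    - apply Rmult_le_compat_l; [lra |]. apply Rmult_le_compat_l; lra.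
    - apply Rmult_le_compat_r; [| lra].
      apply Rmult_le_pos; [exact beta_ge0 |].
      rewrite Rmult_assoc. now apply Rmult_le_pos. }
  assert (H3 : - (e * idq) <= B * (nd * nq)).
  { apply Rle_trans with (e * (nd * nq)).
    - rewrite -Ropp_mult_distr_r_reverse. apply Rmult_le_compat_l; lra.
    - apply Rmult_le_compat_r; lra. }
  assert (H4 : 0 <= c * (nq * nq)).
  { apply Rmult_le_pos; [lra | now apply Rmult_le_pos]. }
  set (C := A * beta * L + L + B).
  apply Rle_trans with (2 * (nd * nq) + 2 * (beta * (L * nd * nd))
    + C * (2 * (nd * nq))).
  { unfold C. lra. }
  assert (H5 : 2 * (nd * nq) <= nd * nd + nq * nq).
  { pose proof (Rle_0_sqr (nd - nq)) as Hs. unfold Rsqr in Hs. lra. }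
  assert (C_ge0 : 0 <= C).
  { unfold C. assert (0 <= A * beta * L)
      by (apply Rmult_le_pos; [apply Rmult_le_pos; lra | exact HL0]). lra. }
  assert (H6 : C * (2 * (nd * nq)) <= C * (nd * nd + nq * nq))
    by now apply Rmult_le_compat_l.
  assert (H7 : 0 <= 2 * (beta * L) * (nq * nq)).
  { apply Rmult_le_pos; [| now apply Rmult_le_pos].
    apply Rmult_le_pos; [lra | now apply Rmult_le_pos]. }
  lra.
Qed.

(* The squared distance of the pairs [(x, v + beta grad g(x))] satisfies a
   Gronwall inequality, since the Hessian does not occur in the derivative of
   the second component. *)
Lemma solution_unique (u0 v0 : H) (x v a y w b : R -> H) :
  solution g eps alpha beta t0 u0 v0 x v a ->
  solution g eps alpha beta t0 u0 v0 y w b ->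
  forall T, t0 <= T -> y T = x T.
Proof.
  intros Sx Sy T HT.
  set (q := fun s => minus (plus (v s) (scal beta (gradient g (x s))))
    (plus (w s) (scal beta (gradient g (y s))))).
  set (d := fun s => minus (x s) (y s)).
  set (G := fun s => minus (gradient g (x s)) (gradient g (y s))).
  (* Both trajectories are bounded on [t0, T], so a single Lipschitz constant of the gradient covers
     them. *)
  destruct (half_line_continuous_bounded H t0 T x) as [Mx HMx].
  { apply derivative_on_continuous with v. apply Sx. }
  destruct (half_line_continuous_bounded H t0 T y) as [My HMy].
  { apply derivative_on_continuous with w. apply Sy. }
  destruct (gradient_lipschitz_ball (Rmax Mx My)) as [L [HL0 HL]].
  set (A := alpha / t0).
  assert (A_ge0 : 0 <= A) by (apply Rdiv_le_0_compat; lra).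
  set (K := 1 + 2 * (beta * L) + (A * beta * L + L + eps t0)).
  set (W := fun s => inner (d s) (d s) + inner (q s) (q s)).
  set (d' := fun s => minus (v s) (w s)).
  set (q' := fun s => minus
    (opp (plus (scal (alpha / s) (v s))
        (plus (gradient g (x s)) (scal (eps s) (x s)))))
    (opp (plus (scal (alpha / s) (w s))
        (plus (gradient g (y s)) (scal (eps s) (y s)))))).
  set (W' := fun s => (inner (d' s) (d s) + inner (d s) (d' s))
    + (inner (q' s) (q s) + inner (q s) (q' s))).
  assert (DW : forall t, t0 <= t <= T ->
    filterdiff (V := R_NormedModule) W (half_line_at t0 t)
      (fun h : R => scal h (W' t))).
  { intros t [Ht _].
    assert (Dd : filterdiff d (half_line_at t0 t) (fun h : R => scal h (d' t))).
    { apply: half_line_minus; [now apply Sx | now apply Sy | exact Ht]. }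
    assert (Dq : filterdiff q (half_line_at t0 t) (fun h : R => scal h (q' t))).
    { apply: half_line_minus; [| | exact Ht].
      - now apply half_line_momentum with u0 v0 a.
      - now apply half_line_momentum with u0 v0 b. }
    apply: (half_line_plus R_NormedModule); [| | exact Ht];
      now apply half_line_inner. }
  assert (HW : forall t, t0 <= t <= T -> W' t <= K * W t).
  { intros t Ht.
    assert (HG : norm (G t) <= L * norm (d t)).
    { apply HL.
      - eapply Rle_trans; [now apply HMx | apply Rmax_l].
      - eapply Rle_trans; [now apply HMy | apply Rmax_r]. }
    assert (Ed : d' t = minus (q t) (scal beta (G t)))
      by (unfold d', q, G; hilbert_ring).
    assert (Eq : q' t = opp (plus (scal (alpha / t) (d' t))
      (plus (G t) (scal (eps t) (d t)))))
      by (unfold q', d', d, G; hilbert_ring).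
    unfold W', W. rewrite (inner_sym (d t)) (inner_sym (q t) (q' t)).
    pose proof (momentum_inner_le (d t) (q t) (G t) L (alpha / t) A
      (eps t) (eps t0) HL0) as Hm.
    rewrite -Ed -Eq in Hm.
    assert (Hm' : 2 * inner (d' t) (d t) + 2 * inner (q' t) (q t)
      <= K * (inner (d t) (d t) + inner (q t) (q t))); [| lra].
    apply Hm; [| | exact HG].
    - split; [apply Rdiv_le_0_compat; lra |].
      apply Rmult_le_compat_l; [exact alpha_ge0 |].
      apply Rinv_le_contravar; lra.
    - split; [apply eps_ge0 | apply eps_noninc]; lra. }
  assert (Hdecr : W T * exp (- K * T) <= W t0 * exp (- K * t0)).
  { apply (nonincreasing_of_derivative_nonpos t0 T
      (fun s => W s * exp (- K * s))
      (fun s => W' s * exp (- K * s) + W s * (- K * exp (- K * s))) HT).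
    - intros t Ht.
      apply (half_line_mult t0 t W (fun s => exp (- K * s)));
        [now apply DW | | apply Ht].
      apply (half_line_of_is_derive R_NormedModule t0 t
        (fun s => exp (- K * s))); [| apply Ht].
      auto_derive; [trivial | ring].
    - intros t Ht. specialize (HW t Ht).
      pose proof (exp_pos (- K * t)). nra. }
  assert (W0 : W t0 = 0).
  { destruct Sx as [_ [_ [_ [Ex Ev]]]]. destruct Sy as [_ [_ [_ [Ey Ew]]]].
    unfold W, d, q. rewrite Ex Ey Ev Ew. inner_expand. ring. }
  rewrite W0 Rmult_0_l in Hdecr.
  assert (Hd0 : inner (d T) (d T) = 0).
  { pose proof (inner_ge_0 (d T)). pose proof (inner_ge_0 (q T)).
    pose proof (exp_pos (- K * T)).
    assert (W T <= 0) by (apply Rnot_lt_le; intros Hp; nra).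
    unfold W in *. lra. }
  apply inner_self_eq_zero in Hd0.
  apply inner_ext. intros h.
  pose proof (f_equal (fun z => inner z h) Hd0) as E.
  revert E. unfold d. simpl. inner_expand. lra.
Qed.

(** Strong continuity handles only the fixed direction [v0]. The moving direction needs Hessians
    uniformly bounded near [x0], and the Lipschitz constant of the gradient on the ball of radius
    |x0| + 1 is such a bound. *)
Lemma hessian_along_continuous (F : (R -> Prop) -> Prop) (x v : R -> H)
    (x0 v0 : H) : Filter F ->
  hessian_continuous g ->
  filterlim x F (locally x0) -> filterlim v F (locally v0) ->
  filterlim (fun s => hessian g (x s) (v s)) F (locally (hessian g x0 v0)).
Proof.
  intros FF Ch Cx Cv.
  destruct (gradient_lipschitz_ball (norm x0 + 1)) as [L [HL0 HL]].
  apply (filterlim_locally_ball_norm (U := H)). intros e.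
  assert (He2 : 0 < e / 2) by (pose proof (cond_pos e); lra).
  assert (HeL : 0 < e / 2 / (L + 1)) by (apply Rdiv_lt_0_compat; lra).
  assert (H1 : F (fun s => norm (minus (x s) x0) < 1)).
  { exact (Cx _ (locally_ball_norm x0 (mkposreal 1 Rlt_0_1))). }
  assert (H2 : F (fun s => norm (minus (v s) v0) < e / 2 / (L + 1))).
  { exact (Cv _ (locally_ball_norm v0 (mkposreal _ HeL))). }
  assert (H3 : F (fun s =>
    norm (minus (hessian g (x s) v0) (hessian g x0 v0)) < e / 2)).
  { exact (Cx _ (Ch v0 x0 _ (locally_ball_norm _ (mkposreal _ He2)))). }
  generalize (filter_and _ _ H1 (filter_and _ _ H2 H3)).
  apply filter_imp. intros s [Hs1 [Hs2 Hs3]].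
  change (norm (minus (hessian g (x s) (v s)) (hessian g x0 v0)) < e).
  eapply Rle_lt_trans; [apply (norm_minus_triangle H _ (hessian g (x s) v0)) |].
  assert (Hxs : norm (x s) < norm x0 + 1).
  { replace (x s) with (plus (minus (x s) x0) x0) by hilbert_ring.
    eapply Rle_lt_trans; [apply: norm_triangle |].
    change (norm (minus (x s) x0) + norm x0 < norm x0 + 1). lra. }
  pose proof (proj1 (hessian_spec H g (x s) (proj2 g_diff2 (x s)))) as Hlin.
  assert (E : minus (hessian g (x s) (v s)) (hessian g (x s) v0)
    = hessian g (x s) (minus (v s) v0)).
  { replace (minus (v s) v0) with (plus (v s) (scal (- (1)) v0))
      by hilbert_ring.
    rewrite (linear_plus _ Hlin) (linear_scal _ Hlin). hilbert_ring. }
  rewrite E.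
  assert (norm (hessian g (x s) (minus (v s) v0)) <= e / 2).
  { eapply Rle_trans; [apply (hessian_norm_le H g (norm x0 + 1) L) |].
    - exact HL0.
    - exact HL.
    - apply g_diff2.
    - exact Hxs.
    - apply Rle_trans with (L * (e / 2 / (L + 1))).
      + apply Rmult_le_compat_l; lra.
      + apply Rle_trans with ((L + 1) * (e / 2 / (L + 1))).
        * apply Rmult_le_compat_r; lra.
        * right. field. lra. }
  lra.
Qed.

Lemma acceleration_continuous (x v a : R -> H) :
  (0 < beta -> hessian_continuous g) ->
  continuous_on_half_line (V := R_NormedModule) t0 eps ->
  derivative_on t0 x v -> derivative_on t0 v a ->
  continuous_on_half_line t0 (acceleration x v).
Proof.
  intros Ch Ceps Dx Dv t Ht.
  pose proof (half_line_proper t0 t Ht) as HP.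
  pose proof (derivative_on_continuous H t0 x v Dx t Ht) as Cx.
  pose proof (derivative_on_continuous H t0 v a Dv t Ht) as Cv.
  unfold acceleration.
  apply: filterlim_comp; [| apply: filterlim_opp].
  apply: filterlim_comp_2; [| | apply: filterlim_plus].
  - apply: (filterlim_comp_2 (fun s => alpha / s));
      [| exact Cv | apply: filterlim_scal].
    apply: filterlim_filter_le_1; [apply filter_le_within |].
    apply: (ex_derive_continuous (fun s => alpha / s)).
    auto_derive. lra.
  - apply: filterlim_comp_2; [| | apply: filterlim_plus].
    (* Continuity of the Hessian is granted only for positive beta; for beta = 0 its term is
       constantly zero. *)
    + destruct beta_ge0 as [Hb | <-].
      * exact (filterlim_comp _ _ _ _ _ _ _ _
          (hessian_along_continuous _ x v _ _ _ (Ch Hb) Cx Cv)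
          (filterlim_scal_r beta (hessian g (x t) (v t)))).
      * apply filterlim_ext with (fun _ => scal 0 (hessian g (x t) (v t))).
        { intros s. hilbert_ring. }
        apply filterlim_const.
    + apply: filterlim_comp_2; [| | apply: filterlim_plus].
      * apply: filterlim_comp; [exact Cx |].
        apply: filterdiff_continuous. apply g_diff2.
      * apply: (filterlim_comp_2 eps);
          [now apply Ceps | exact Cx | apply: filterlim_scal].
Qed.

End Cauchy_problem.

(* For beta > 0 the last derivative need not be continuous when the Hessian is
   not: with g' (s) = 3 s + s^2 sin (1/s) near 0 on the real line, u0 = 0 and
   v0 = 1, the term beta * g'' (x t) * x' t has no limit at t0. *)
Theorem theorem2p1 (H : Hilbert) (g : H -> R) (eps : R -> R)
    (alpha beta t0 : R)
    (g_convex : convex g)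
    (g_diff2 : twice_frechet_differentiable g)
    (grad_lip : lipschitz_on_bounded_sets (gradient g))
    (g_argmin : exists z : H, argmin g z)
    (eps_ge0 : forall t : R, t0 <= t -> 0 <= eps t)
    (eps_noninc : forall s t : R, t0 <= s -> s <= t -> eps t <= eps s)
    (eps_C1 : C1_on_half_line t0 eps)
    (eps_lim : is_lim eps p_infty 0)
    (alpha_ge3 : 3 <= alpha) (beta_ge0 : 0 <= beta) (t0_gt0 : 0 < t0)
    (u0 v0 : H) :
  exists x x' x'' : R -> H,
    solution g eps alpha beta t0 u0 v0 x x' x'' /\
    ((0 < beta -> hessian_continuous g) -> continuous_on_half_line t0 x'') /\
    (forall y y' y'' : R -> H,
       solution g eps alpha beta t0 u0 v0 y y' y'' ->
       forall t : R, t0 <= t -> y t = x t).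
Proof.
  assert (alpha_ge0 : 0 <= alpha) by lra.
  destruct (solution_exists H g eps alpha beta t0 g_convex g_diff2 grad_lip
    g_argmin eps_ge0 eps_noninc eps_C1 alpha_ge0 beta_ge0 t0_gt0 u0 v0)
    as [x [v S]].
  exists x, v, (acceleration H g eps alpha beta x v).
  refine (conj S (conj _ _)).
  - intros Ch.
    destruct eps_C1 as [eps' [Deps _]].
    apply: (acceleration_continuous H g eps alpha beta t0) Ch _
      (proj1 S) (proj1 (proj2 S)); try assumption.
    exact (derivative_on_continuous R_NormedModule t0 eps eps' Deps).
  - intros y w b Sy.
    apply: (solution_unique H g eps alpha beta t0) S Sy; assumption.
Qed.
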